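(* Let $R$ be an associative ring with identity. The following assertions are equivalent: (1) The ring $R$ is right coherent. (2) For any left $R$-module $M$ and any right $R$-module $N$, $N\in\mathcal{A}p(M)$ if and only if $N^+\in\mathfrak{F}^{-1}(M)$. (3) For any finitely presented left $R$-module $M$ and any left $R$-module $N$, $N\in\mathfrak{F}^{-1}(M)$ if and only if $N^{++}\in\mathfrak{F}^{-1}(M)$.
   Context: Modules are unital; $N^+=\mathrm{Hom}_{\mathbb{Z}}(N,\mathbb{Q}/\mathbb{Z})$ is the character module of $N$ and $N^{++}=(N^+)^+$. A flat precover of a module $N$ is a morphism $g:F\to N$ with $F$ flat such that $\mathrm{Hom}(F',F)\to\mathrm{Hom}(F',N)$ is surjective for every flat module $F'$. For a left $R$-module $M$, the flat-precover completing domain $\mathfrak{F}^{-1}(M)$ is the class of all left $R$-modules $N$ such that for every morphism $f:M\to N$ and every flat precover $g:F\to N$ there is a morphism $h:M\to F$ with $gh=f$; the absolutely pure domain $\mathcal{A}p(M)$ is the class of all right $R$-modules $L$ such that $L\otimes_R M\to K\otimes_R M$ is a monomorphism for every right $R$-module $K$ containing $L$ as a submodule. *)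

(* Defs.v *)
From HB Require Import structures.
From mathcomp Require Import all_boot all_order all_algebra.
From mathcomp Require Import ring_quotient.
From mathcomp Require Import boolp freeg.

Set Implicit Arguments.
Unset Strict Implicit.
Unset Printing Implicit Defensive.

Import GRing.Theory.

Local Open Scope ring_scope.
Local Open Scope quotient_scope.

Local Notation "V ^z" := (zmodule V) (at level 2, format "V ^z") : type_scope.

(* Left modules over R have type lmodType R. Right modules over R are left
   modules over the converse ring R^c, that is, x r is rendered by
   (r : R^c) *: x. *)

Section Tensor.

Variables (R : pzRingType) (L : lmodType R^c) (M : lmodType R).

Notation free := {freeg (L * M)%type / int}.

Inductive tensor_rel : free -> Prop :=
| tensor_rel0 : tensor_rel 0
| tensor_relB x y : tensor_rel x -> tensor_rel y -> tensor_rel (x - y)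
| tensor_relDl a a' m :
    tensor_rel (<< (a + a', m) >> - << (a, m) >> - << (a', m) >>)
| tensor_relDr a m m' :
    tensor_rel (<< (a, m + m') >> - << (a, m) >> - << (a, m') >>)
| tensor_relZ (r : R) a m :
    tensor_rel (<< ((r : R^c) *: a, m) >> - << (a, r *: m) >>).

Definition tensor_relb : {pred free} := fun x => `[< tensor_rel x >].

Lemma tensor_relbP x : reflect (tensor_rel x) (x \in tensor_relb).
Proof. exact: asboolP. Qed.

Lemma tensor_relb_zmod_closed : zmod_closed tensor_relb.
Proof.
split; first exact/tensor_relbP/tensor_rel0.
by move=> x y /tensor_relbP hx /tensor_relbP hy; apply/tensor_relbP/tensor_relB.
Qed.

HB.instance Definition _ :=
  GRing.isZmodClosed.Build free tensor_relb tensor_relb_zmod_closed.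

Definition tensor : Type := {ideal_quot tensor_relb}.

HB.instance Definition _ := GRing.Zmodule.copy tensor {ideal_quot tensor_relb}.

Definition tens (a : L) (m : M) : tensor := \pi_{ideal_quot tensor_relb} << (a, m) >>.

(* Junk unless b is balanced; see tensor_lift_tens. The
   coefficients being integers, V is seen as the Z-module V^z. *)
Definition tensor_lift (V : zmodType) (b : L -> M -> V) (x : tensor) : V :=
  fglift (fun p => b p.1 p.2 : V^z) (repr (x : {ideal_quot tensor_relb})).

Definition balanced (V : zmodType) (b : L -> M -> V) : Prop :=
  [/\ forall a a' m, b (a + a') m = b a m + b a' m,
      forall a m m', b a (m + m') = b a m + b a m' &
      forall (r : R) a m, b ((r : R^c) *: a) m = b a (r *: m)].

Section Lift.

Variables (V : zmodType) (b : L -> M -> V).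
Hypothesis bal_b : balanced b.

Notation lft := (fglift (fun p : L * M => b p.1 p.2 : V^z)).

Lemma lftB (x y : free) : lft (x - y) = lft x - lft y.
Proof. exact: lift_is_additive. Qed.

Lemma lftU (a : L) (m : M) : lft << (a, m) >> = b a m.
Proof. by rewrite liftU scale1r. Qed.

Lemma lft_rel (x : free) : tensor_rel x -> lft x = 0.
Proof.
case: bal_b => bDl bDr bZ; elim=> {x}.
- by rewrite -[X in lft X](subrr (0 : free)) lftB subrr.
- by move=> x y _ hx _ hy; rewrite lftB hx hy subrr.
- by move=> a a' m; rewrite !lftB !lftU bDl addrAC addrK subrr.
- by move=> a m m'; rewrite !lftB !lftU bDr addrAC addrK subrr.
- by move=> r a m; rewrite lftB !lftU bZ subrr.
Qed.

Lemma tensor_lift_pi (x : free) :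
  tensor_lift b (\pi_{ideal_quot tensor_relb} x) = lft x.
Proof.
apply/eqP; rewrite -subr_eq0 /tensor_lift -lftB; apply/eqP/lft_rel/tensor_relbP.
by rewrite Quotient.idealrBE reprK.
Qed.

Lemma tensor_lift_zmod_morphism : zmod_morphism (tensor_lift b).
Proof.
move=> x y; rewrite -[x](@reprK _ {ideal_quot tensor_relb}).
rewrite -[y](@reprK _ {ideal_quot tensor_relb}) !tensor_lift_pi -lftB.
by rewrite -tensor_lift_pi raddfB.
Qed.

Lemma tensor_lift_tens a m : tensor_lift b (tens a m) = b a m.
Proof. by rewrite tensor_lift_pi lftU. Qed.

End Lift.

Lemma tens_balanced : balanced tens.
Proof.
have piE0 (x : free) : tensor_rel x -> \pi_{ideal_quot tensor_relb} x = 0.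
  move=> hx; rewrite -(raddf0 \pi_{ideal_quot tensor_relb}).
  by apply/eqP; rewrite -Quotient.idealrBE subr0; apply/tensor_relbP.
split=> [a a' m|a m m'|r a m]; apply/eqP; rewrite -subr_eq0 ?opprD ?addrA.
- by apply/eqP; rewrite -(piE0 _ (tensor_relDl a a' m)) !raddfB.
- by apply/eqP; rewrite -(piE0 _ (tensor_relDr a m m')) !raddfB.
- by apply/eqP; rewrite -(piE0 _ (tensor_relZ r a m)) !raddfB.
Qed.

End Tensor.

Section TensorMap.

Variables (R : pzRingType) (L K : lmodType R^c) (M : lmodType R).

(* i (x) id_M *)
Definition tensor_map (i : {linear L -> K}) : tensor L M -> tensor K M :=
  tensor_lift (fun a m => tens (i a) m).

Lemma tensor_map_balanced (i : {linear L -> K}) :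
  balanced (fun (a : L) (m : M) => tens (i a) m).
Proof.
have [tDl tDr tZ] := tens_balanced K M.
by split=> *; rewrite ?linearD ?linearZ ?tDl ?tDr ?tZ.
Qed.

Lemma tensor_map_tens (i : {linear L -> K}) a m :
  tensor_map i (tens a m) = tens (i a) m.
Proof. exact: tensor_lift_tens (tensor_map_balanced i) a m. Qed.

Lemma tensor_map_zmod_morphism (i : {linear L -> K}) :
  zmod_morphism (tensor_map i).
Proof. exact: tensor_lift_zmod_morphism (tensor_map_balanced i). Qed.

End TensorMap.

Arguments tensor_map {R L K} M i.

Definition rat_int : {pred rat} := fun q => q \is a Num.int.

Lemma rat_int_zmod_closed : zmod_closed rat_int.
Proof. by split=> [|x y hx hy]; [apply: rpred0 | apply: rpredB]. Qed.

HB.instance Definition _ :=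
  GRing.isZmodClosed.Build rat rat_int rat_int_zmod_closed.

Definition QZ : Type := {ideal_quot rat_int}.

HB.instance Definition _ := GRing.Zmodule.copy QZ {ideal_quot rat_int}.

Section CharacterGroup.

Variable N : zmodType.

Definition char : Type := {additive N -> QZ}.

Definition char_fun (f : char) : N -> QZ := (f : {additive N -> QZ}).
Coercion char_fun : char >-> Funclass.

HB.instance Definition _ (f : char) :=
  GRing.Additive.copy (char_fun f) (f : {additive N -> QZ}).

Lemma charP (f g : char) : f =1 g -> f = g.
Proof.
move=> /funext; case: f g => f [[hf]] [g [[hg]]]; rewrite /char_fun /= => efg.
by subst g; rewrite (Prop_irrelevance hf hg).
Qed.

HB.instance Definition _ := gen_eqMixin char.
HB.instance Definition _ := gen_choiceMixin char.

Definition char0 : char := GRing.Additive.clone N QZ \0 _.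
Definition charD (f g : char) : char := GRing.Additive.clone N QZ (f \+ g) _.
Definition charN (f : char) : char := GRing.Additive.clone N QZ (-%R \o f) _.

Lemma charDA : associative charD.
Proof. by move=> f g h; apply: charP => x; apply: addrA. Qed.
Lemma charDC : commutative charD.
Proof. by move=> f g; apply: charP => x; apply: addrC. Qed.
Lemma char0D : left_id char0 charD.
Proof. by move=> f; apply: charP => x; apply: add0r. Qed.
Lemma charND : left_inverse char0 charN charD.
Proof. by move=> f; apply: charP => x; apply: addNr. Qed.

HB.instance Definition _ :=
  GRing.isZmodule.Build char charDA charDC char0D charND.

End CharacterGroup.

Section CharacterPrecomp.

Variables (S : pzRingType) (N : lmodType S).

Definition char_precomp_fun (s : S) (f : char N) (x : N) : QZ := f (s *: x).

Lemma char_precomp_subproof s f : zmod_morphism (char_precomp_fun s f).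
Proof. by move=> x y; rewrite /char_precomp_fun scalerBr raddfB. Qed.

HB.instance Definition _ s f :=
  GRing.isZmodMorphism.Build N QZ (char_precomp_fun s f)
    (char_precomp_subproof s f).

Definition char_precomp (s : S) (f : char N) : char N :=
  GRing.Additive.clone N QZ (char_precomp_fun s f) _.

Lemma char_precompM s t f :
  char_precomp s (char_precomp t f) = char_precomp (t * s) f.
Proof. by apply: charP => x; congr (f _); rewrite scalerA. Qed.

Lemma char_precomp1 : left_id 1 char_precomp.
Proof. by move=> f; apply: charP => x; congr (f _); rewrite scale1r. Qed.

Lemma char_precompDr : right_distributive char_precomp +%R.
Proof. by move=> s f g; apply: charP. Qed.

Lemma char_precompDl f : {morph char_precomp^~ f : s t / s + t}.
Proof.
move=> s t; apply: charP => x.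
by rewrite [LHS]/char_fun /= /char_precomp_fun scalerDl raddfD.
Qed.

End CharacterPrecomp.

(* N^+ for a right module N: the left module with (r f)(x) = f(x r). *)
Definition charr (R : pzRingType) (N : lmodType R^c) : Type := char N.

(* N^+ for a left module N: the right module with (f r)(x) = f(r x). *)
Definition charl (R : pzRingType) (N : lmodType R) : Type := char N.

Section CharacterModule.

Variable R : pzRingType.

HB.instance Definition _ (N : lmodType R^c) :=
  GRing.Zmodule.copy (charr N) (char N).

Definition charr_scale (N : lmodType R^c) (r : R) (f : charr N) : charr N :=
  char_precomp (r : R^c) f.

Lemma charr_scaleA (N : lmodType R^c) (r s : R) (f : charr N) :
  charr_scale r (charr_scale s f) = charr_scale (r * s) f.
Proof. exact: char_precompM. Qed.

HB.instance Definition _ (N : lmodType R^c) :=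
  GRing.Zmodule_isLmodule.Build R (charr N) (@charr_scaleA N)
    (@char_precomp1 _ N) (@char_precompDr _ N) (@char_precompDl _ N).

HB.instance Definition _ (N : lmodType R) :=
  GRing.Zmodule.copy (charl N) (char N).

Definition charl_scale (N : lmodType R) (r : R^c) (f : charl N) : charl N :=
  char_precomp (r : R) f.

Lemma charl_scaleA (N : lmodType R) (r s : R^c) (f : charl N) :
  charl_scale r (charl_scale s f) = charl_scale (r * s) f.
Proof. exact: char_precompM. Qed.

HB.instance Definition _ (N : lmodType R) :=
  GRing.Zmodule_isLmodule.Build R^c (charl N) (@charl_scaleA N)
    (@char_precomp1 _ N) (@char_precompDr _ N) (@char_precompDl _ N).

End CharacterModule.

Definition fin_generated (S : pzRingType) (M : lmodType S) : Prop :=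
  exists (n : nat) (g : {linear 'rV[S]_n -> M}), forall y, exists x, g x = y.

(* There is an exact sequence S^m -> S^n -> M -> 0. *)
Definition fin_presented (S : pzRingType) (M : lmodType S) : Prop :=
  exists (m n : nat) (f : {linear 'rV[S]_m -> 'rV[S]_n})
         (g : {linear 'rV[S]_n -> M}),
    (forall y, exists x, g x = y) /\
    (forall x, g x = 0 <-> exists z, f z = x).

(* Every finitely generated right ideal is finitely presented. A right ideal is
   a submodule of R_R, given by its inclusion i. *)
Definition right_coherent (R : pzRingType) : Prop :=
  forall (I : lmodType R^c) (i : {linear I -> (R^c)^o}),
    injective i -> fin_generated I -> fin_presented I.

Section Domains.

Variable R : pzRingType.

Definition flat (F : lmodType R) : Prop :=
  forall (A B : lmodType R^c) (i : {linear A -> B}),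
    injective i -> injective (tensor_map F i).

Definition flat_precover (F N : lmodType R) (g : {linear F -> N}) : Prop :=
  flat F /\
  forall (F' : lmodType R), flat F' ->
    forall u : {linear F' -> N},
      exists v : {linear F' -> F}, forall x, g (v x) = u x.

Definition flat_completing_domain (M N : lmodType R) : Prop :=
  forall (f : {linear M -> N}) (F : lmodType R) (g : {linear F -> N}),
    flat_precover g -> exists h : {linear M -> F}, forall x, g (h x) = f x.

(* A module K containing L as a submodule is given by the inclusion i. *)
Definition abs_pure_domain (M : lmodType R) (L : lmodType R^c) : Prop :=
  forall (K : lmodType R^c) (i : {linear L -> K}),
    injective i -> injective (tensor_map M i).

End Domains.

(* Main.v *)
(** Equational flatness and injectivity of the character module both characterize
flat modules, and [N (x) M -> K (x) M] is injective iff every map [M -> N^+] extends to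
[M -> K^+]. Since every module has a flat precover, [N] is in the flat-precover
completing domain of [M] iff every map [M -> N] factors through a flat module. Over a
right coherent ring [E^+] is flat for [E] injective, so that [E^+ -> N^+] decides both
sides of (2), for an injective [E] containing [N]; for (3), [M] being finitely
presented, [Hom(M, G) -> Hom(M, N)] is onto iff [Hom(M, G^++) -> Hom(M, N^++)] is.
Conversely, (2) and (3) each make [E^+] flat for every injective right module [E], and
this forces coherence (Chase): the relations of [r] are finitely generated because
they are so from some point on in a suitable product of injectives.

A flat precover of [N] is generated by formal solutions of all the lifting problems
[X -> G] over [N] with [G] one fixed free module and [G / X] flat. These solutions live
in [N] times a power of an injective module, where each has a coordinate of its own;
hence nothing but flat quotients [G / X] is added and the result is flat. As each nonzero flat
module has a nonzero pure submodule that is an image of [G], Zorn's lemma then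
lifts every map from a flat module to [N]. *)

Require Import Defs.
From HB Require Import structures.
From mathcomp Require Import all_boot all_order all_algebra.
From mathcomp Require Import ring_quotient boolp freeg classical_sets functions.

Set Implicit Arguments.
Unset Strict Implicit.
Unset Printing Implicit Defensive.

Import GRing.Theory Num.Theory.

Local Open Scope ring_scope.

(** [Zorn_bigcup] also asks for the union of the empty chain, so the empty set is adjoined to [P]; a
    maximal element outside [P] is then excluded by means of [A0]. *)
Lemma Zorn_max (T : Type) (P : set T -> Prop) (A0 : set T) :
    P A0 ->
    (forall F : set (set T), (exists A, F A) -> (forall A, F A -> P A) ->
      (forall A B, F A -> F B -> (A `<=` B \/ B `<=` A)%classic) ->
      P (fun x => exists2 A, F A & A x)) ->
  exists2 A, P A & forall B, (A `<=` B)%classic -> P B -> (B `<=` A)%classic.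
Proof.
move=> PA0 Pcup; pose P' : set (set T) := fun A => A = set0 \/ P A.
have [F FP' totF|A [P'A Amax]] := @Zorn_bigcup T P'.
  have [[A [FA PA]]|noP] := pselect (exists A, F A /\ P A); last first.
    left; rewrite bigcup0 // => A FA.
    by case: (FP' A FA) => // PA; case: noP; exists A.
  right; pose F' : set (set T) := fun B => F B /\ P B.
  have -> : (\bigcup_(X in F) X = fun x => exists2 B, F' B & B x)%classic.
    apply/seteqP; split=> x [B FB Bx]; last by exists B => //; case: FB.
    exists B => //; split=> //; case: (FP' B FB) => // B0.
    by move: Bx; rewrite B0.
  apply: Pcup; first by exists A.
    by move=> B [].
  by move=> B C [FB _] [FC _]; apply: totF.
have PA : P A.
  case: P'A => // A_0; have [A00|A0N0] := pselect (A0 = set0).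
    by rewrite A_0 -A00.
  exfalso; apply: (Amax A0); last by right.
  by rewrite A_0; split=> [x []|]; rewrite subset0.
exists A => // B sAB PB; apply: contrapT => nsBA.
by apply: (Amax B); [split | right].
Qed.

(** * Submodules, partial linear maps and Baer's criterion *)

Section Submodules.

Variables (S : pzRingType) (V : lmodType S).

Definition submod (P : V -> Prop) : Prop :=
  P 0 /\ forall a x y, P x -> P y -> P (a *: x + y).

Section Closure.

Variable P : V -> Prop.
Hypothesis subP : submod P.

Lemma submod0 : P 0. Proof. by case: subP. Qed.

Lemma submodZ a x : P x -> P (a *: x).
Proof. by move=> Px; rewrite -[_ *: _]addr0; apply: subP.2 => //; apply: submod0. Qed.

Lemma submodD x y : P x -> P y -> P (x + y).
Proof. by move=> Px Py; rewrite -[x]scale1r; apply: subP.2. Qed.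

Lemma submodN x : P x -> P (- x).
Proof. by move=> Px; rewrite -scaleN1r; apply: submodZ. Qed.

Lemma submodB x y : P x -> P y -> P (x - y).
Proof. by move=> Px Py; apply/submodD/submodN. Qed.

Lemma submod_sum (I : Type) (r : seq I) (F : I -> V) :
  (forall i, P (F i)) -> P (\sum_(i <- r) F i).
Proof. by move=> PF; elim/big_ind: _ => //; [apply: submod0 | apply: submodD]. Qed.

End Closure.

(** The proof [subP] is an argument so that the closure structure can be inferred from the predicate
    alone. *)
Definition subm_pred (P : V -> Prop) (subP : submod P) : {pred V} :=
  fun x => `[< P x >].

Lemma subm_predP P (subP : submod P) x : reflect (P x) (x \in subm_pred subP).
Proof. exact: asboolP. Qed.

Lemma subm_pred_closed P (subP : submod P) : submod_closed (subm_pred subP).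
Proof.
split; first by apply/subm_predP; apply: submod0.
move=> a x y /subm_predP Px /subm_predP Py.
by apply/subm_predP; apply: subP.2.
Qed.

HB.instance Definition _ P (subP : submod P) :=
  GRing.isSubmodClosed.Build S V (subm_pred subP) (subm_pred_closed subP).

Record subm P (subP : submod P) : Type :=
  Subm { subm_val : V; subm_valP : subm_val \in subm_pred subP }.

HB.instance Definition _ P (subP : submod P) :=
  [isSub for @subm_val P subP].
HB.instance Definition _ P (subP : submod P) :=
  [Choice of subm subP by <:].
HB.instance Definition _ P (subP : submod P) :=
  [SubChoice_isSubLmodule of subm subP by <:].

Lemma submP P (subP : submod P) (x : subm subP) : P (\val x).
Proof. by apply/subm_predP/valP. Qed.

Lemma subm_ex P (subP : submod P) x : P x -> exists y : subm subP, \val y = x.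
Proof. by move=> /(subm_predP subP) Px; exists (Subm Px). Qed.

End Submodules.

Section LinearMaps.

Variable S : pzRingType.

Lemma mk_linear (V W : lmodType S) (f : V -> W) :
  (forall a x y, f (a *: x + y) = a *: f x + f y) ->
  exists h : {linear V -> W}, h =1 f.
Proof.
move=> lf; pose h : {linear V -> W} := HB.pack f (GRing.isLinear.Build S V W *:%R f lf).
by exists h.
Qed.

Lemma mk_additive (V W : zmodType) (f : V -> W) :
  (forall x y, f (x + y) = f x + f y) ->
  exists h : {additive V -> W}, h =1 f.
Proof.
move=> fD; have f0 : f 0 = 0 by apply: (addrI (f 0)); rewrite -fD !addr0.
have fB : zmod_morphism f.
  move=> x y; apply: (addIr (f y)); rewrite -fD !subrK //.
pose h : {additive V -> W} := HB.pack f (GRing.isZmodMorphism.Build V W f fB).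
by exists h.
Qed.

Lemma comp_linear (U V W : lmodType S) (f : {linear V -> W}) (g : {linear U -> V}) :
  exists h : {linear U -> W}, forall x, h x = f (g x).
Proof. by exists (f \o g). Qed.

(* Partial linear maps are handled through their graphs. *)
Definition pgraph (V E : lmodType S) (H : V * E -> Prop) : Prop :=
  submod H /\ forall e, H (0, e) -> e = 0.

Lemma pgraph_fun (V E : lmodType S) (H : V * E -> Prop) v e e' :
  pgraph H -> H (v, e) -> H (v, e') -> e = e'.
Proof.
move=> [subH H0] He He'; apply/eqP; rewrite -subr_eq0; apply/eqP/H0.
have : H (v - v, e - e') by apply: (submodB subH He He').
by rewrite subrr.
Qed.

Lemma pgraph_total (V E : lmodType S) (H : V * E -> Prop) :
  pgraph H -> (forall v, exists e, H (v, e)) ->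
  exists h : {linear V -> E}, forall v, H (v, h v).
Proof.
move=> gH /choice[f Hf]; have [a x y|h hE] := @mk_linear V E f.
  apply: (pgraph_fun gH (Hf _)); exact: gH.1.2 (Hf x) (Hf y).
by exists h => v; rewrite hE.
Qed.

(** Injectivity in Baer's form: [H] is a map to [E] from a left ideal of [S], and [e0] is the value
    at 1 of an extension to [S]. *)
Definition baer (E : lmodType S) : Prop :=
  forall H : S^o * E -> Prop, pgraph H ->
    exists e0 : E, forall (s : S) (e : E), H (s, e) -> e = s *: e0.

Lemma baer_ext (V E : lmodType S) (H : V * E -> Prop) :
  baer E -> pgraph H ->
  exists h : {linear V -> E}, forall v e, H (v, e) -> h v = e.
Proof.
move=> bE gH.
have [||A [sHA gA] Amax] := @Zorn_max _
  (fun A : V * E -> Prop => (forall p, H p -> A p) /\ pgraph A) H.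
- by [].
- move=> F [A FA] FP totF; split.
    by move=> p Hp; exists A => //; apply: (FP A FA).1.
  split; last by move=> e [B FB Be]; apply: (FP B FB).2.2.
  split; first by exists A => //; apply: (submod0 (FP A FA).2.1).
  move=> a x y [B FB Bx] [C FC Cy]; have [sBC|sCB] := totF B C FB FC.
    by exists C => //; apply: (FP C FC).2.1.2 => //; apply: sBC.
  by exists B => //; apply: (FP B FB).2.1.2 => //; apply: sCB.
have Atot b : exists e, A (b, e).
  (* One-step extension to [b]: the partial map s |-> A(s b) is multiplication by [e0], so [e0] is a
     consistent value at [b], which [A'] adds to the graph. *)
  have [|e0 He0] := bE (fun p : S^o * E => A ((p.1 : S) *: b, p.2)).
    split.
      split; first by rewrite scale0r; apply: (submod0 gA.1).
      move=> a [s e] [s' e'] /= As As'.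
      have : A (a *: ((s : S) *: b) + (s' : S) *: b, a *: e + e').
        exact: (gA.1.2 a _ _ As As').
      by rewrite scalerA -scalerDl.
    by move=> e; rewrite /= scale0r => /gA.2.
  pose A' (p : V * E) := exists (s : S) v e,
    A (v, e) /\ p = (v + s *: b, e + s *: e0).
  exists e0; apply: (Amax A'); last 1 first.
  - by exists 1, 0, 0; rewrite !scale1r !add0r; split=> //; apply: (submod0 gA.1).
  - by move=> [v e] Av; exists 0, v, e; rewrite !scale0r !addr0.
  split.
    move=> [v e] Hv; exists 0, v, e.
    by rewrite !scale0r !addr0; split=> //; apply: sHA.
  split.
    split.
      by exists 0, 0, 0; rewrite !scale0r !addr0; split=> //; apply: (submod0 gA.1).
    move=> a _ _ [s [v [e [Av ->]]]] [s' [v' [e' [Av' ->]]]].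
    exists (a * s + s'), (a *: v + v'), (a *: e + e'); split.
      exact: (gA.1.2 a _ _ Av Av').
    by congr pair => /=; rewrite scalerDl scalerDr scalerA addrACA.
  move=> _ [s [v [e [Av [Ev ->]]]]].
  have sb : s *: b = - v by apply/eqP; rewrite -addr_eq0 addrC -Ev.
  have : A (- v, - e) by apply: (submodN gA.1 Av).
  by rewrite -sb => /He0 <-; rewrite subrr.
have [h hA] := pgraph_total gA Atot.
by exists h => v e /sHA Av; apply: pgraph_fun gA (hA v) Av.
Qed.

Lemma baer_lift (V W E : lmodType S) (i : {linear V -> W}) (f : {linear V -> E}) :
  baer E -> injective i -> exists h : {linear W -> E}, forall v, h (i v) = f v.
Proof.
move=> bE inji.
have [|h hE] := @baer_ext W E (fun p => exists2 v, p.1 = i v & p.2 = f v) bE.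
  split; last first.
    move=> e [v /= iv ->]; suff -> : v = 0 by rewrite linear0.
    by apply: inji; rewrite linear0.
  split; first by exists 0; rewrite linear0.
  by move=> a [? ?] [? ?] /= [v -> ->] [v' -> ->]; exists (a *: v + v'); rewrite linearP.
by exists h => v; apply: hE; exists v.
Qed.

Lemma baer_fun (I : Type) (E : lmodType S) : baer E -> baer (I -> E).
Proof.
move=> bE H gH.
have /choice[e0 He0] i : exists e0 : E,
    forall (s : S) (e : I -> E), H (s, e) -> e i = s *: e0.
  have [|e0 He0] := bE (fun p : S^o * E => exists2 e, H (p.1, e) & p.2 = e i).
    split.
      split; first by exists 0 => //; apply: (submod0 gH.1).
      move=> a [s e] [s' e'] /= [f Hf ->] [f' Hf' ->].
      by exists (a *: f + f') => //; apply: (gH.1.2 a _ _ Hf Hf').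
    by move=> e /= [f /gH.2 -> ->].
  by exists e0 => s e Hs; apply: He0; exists e.
by exists e0 => s e Hs; apply/funext => i; rewrite (He0 i _ _ Hs).
Qed.

End LinearMaps.

(** * Characters *)

Definition subgrp (V : zmodType) (P : V -> Prop) : Prop :=
  P 0 /\ forall x y, P x -> P y -> P (x - y).

Lemma subgrpN (V : zmodType) (P : V -> Prop) x : subgrp P -> P x -> P (- x).
Proof. by move=> [P0 PB] Px; rewrite -sub0r; apply: PB. Qed.

Lemma subgrpD (V : zmodType) (P : V -> Prop) x y :
  subgrp P -> P x -> P y -> P (x + y).
Proof.
by move=> sP Px Py; rewrite -[y]opprK; apply: sP.2 => //; apply: subgrpN.
Qed.

Lemma subgrpMn (V : zmodType) (P : V -> Prop) x n :
  subgrp P -> P x -> P (x *+ n).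
Proof.
move=> sP Px; elim: n => [|n IHn]; first exact: sP.1.
by rewrite mulrS; apply: subgrpD.
Qed.

Lemma subgrpMz (V : zmodType) (P : V -> Prop) x (n : int) :
  subgrp P -> P x -> P (x *~ n).
Proof.
move=> sP Px; case: n => n; first exact: (subgrpMn n sP Px).
by rewrite NegzE mulrNz; apply: (subgrpN sP); apply: (subgrpMn n.+1 sP Px).
Qed.

Lemma submod_grp (S : pzRingType) (V : lmodType S) (P : V -> Prop) :
  submod P -> subgrp P.
Proof. by move=> sP; split; [apply: submod0 | move=> x y; apply: submodB]. Qed.

Lemma int_subgrp (P : int -> Prop) : subgrp P ->
  exists2 d : nat, P d & forall n : int, P n -> exists k : int, n = k * d%:Z.
Proof.
move=> sP; have [noP|] := pselect (forall n : nat, P n.+1 -> False).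
  exists 0%N => [|n Pn]; first exact: sP.1.
  exists 0; rewrite mulr0; case: n Pn => [[//|n] /noP//|n Pn].
  by case: (noP n); have := subgrpN sP Pn; rewrite NegzE opprK.
move=> /existsNP[n0 /contrapT Pn0].
have exP : exists n, `[< (0 < n)%N /\ P n >] by exists n0.+1; apply/asboolP.
case: (ex_minnP exP) => d /asboolP[d_gt0 Pd] dmin; exists d => // n Pn.
exists (n %/ d)%Z; rewrite {1}(divz_eq n d).
have Pr : P (n %% d)%Z.
  have -> : (n %% d)%Z = n - d%:Z *~ (n %/ d)%Z.
    by apply/eqP; rewrite eq_sym subr_eq addrC mulrzz mulrC -divz_eq.
  by apply: sP.2 => //; apply: subgrpMz.
case r0: (n %% d)%Z Pr => [[|r]|r] Pr; first by rewrite addr0.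
  have /dmin : `[< (0 < r.+1)%N /\ P r.+1 >] by apply/asboolP.
  by rewrite leqNgt -ltz_nat -r0 ltz_pmod.
have : (0 <= n %% d)%Z by rewrite modz_ge0 // eqz_nat -lt0n.
by rewrite r0.
Qed.

Lemma QZ_divisible (q : QZ) (d : nat) : (0 < d)%N -> exists q' : QZ, q' *+ d = q.
Proof.
move=> d_gt0; exists (\pi_({ideal_quot rat_int})%qT (repr q / d%:R)).
rewrite -raddfMn -[RHS]reprK; congr (\pi_(_)%qT _).
by rewrite -[LHS]mulr_natr divfK // pnatr_eq0 -lt0n.
Qed.

Lemma QZ_torsion (d : nat) : (1 < d)%N -> exists2 q : QZ, q *+ d = 0 & q <> 0.
Proof.
move=> d_gt1; have d_neq0 : d%:R != 0 :> rat by rewrite pnatr_eq0 -lt0n ltnW.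
pose p := \pi_({ideal_quot rat_int})%qT.
have p0 (x : rat) : p x = 0 <-> x \is a Num.int.
  split=> [|xint]; last first.
    apply/eqP; rewrite -(raddf0 p) -Quotient.idealrBE subr0 //.
  by rewrite -(raddf0 p) => /eqP; rewrite -Quotient.idealrBE subr0.
exists (p d%:R^-1).
  have E1 : d%:R^-1 *+ d = 1 :> rat by rewrite -[LHS]mulr_natr mulVf.
  by rewrite -raddfMn E1; apply/p0; rewrite rpred1.
move/p0 => /Num.Theory.intrP[m Em].
have m1 : (m * d%:Z)%:~R = 1 :> rat by rewrite intrM -Em mulVf.
have {m1} : m * d%:Z = 1 by apply/(@intr_inj rat).
move=> /(congr1 absz); rewrite abszM /= => /eqP; rewrite muln_eq1 => /andP[_ /eqP d1].
by rewrite d1 in d_gt1.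
Qed.

(** Divisibility suffices because ideals of Z are principal: if the domain is d Z with d > 0 and d
    has value e, any q with d q = e works. *)
Lemma QZ_baer : @baer int (zmodule QZ).
Proof.
move=> H gH.
have gr (s : int) (e : QZ) (s' : int) (e' : QZ) :
  H (s, e) -> H (s', e') -> H (s - s', e - e').
  by move=> Hs Hs'; apply: (submodB gH.1 Hs Hs').
have [|d [e Hd] dP] := @int_subgrp (fun s => exists e, H (s, e)).
  split; first by exists 0; apply: (submod0 gH.1).
  by move=> x y [e Hx] [e' Hy]; exists (e - e'); apply: gr.
have gen s e' : H (s, e') -> exists k : int, s = k * d%:Z /\ e' = (e : QZ) *~ k.
  move=> Hs; have [|k Ek] := dP s; first by exists e'.
  exists k; split=> //; apply: (pgraph_fun gH Hs).
  have := submodZ gH.1 k Hd; suff -> : s = k * d%:Z by [].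
  exact: Ek.
have [d0|d_gt0] := posnP d.
  exists 0 => s e' Hs; rewrite scaler0; have [k [Es _]] := gen _ _ Hs.
  by apply: gH.2; move: Hs; rewrite Es d0 mulr0.
have [q Eq] := QZ_divisible e d_gt0.
exists q => s e' /gen[k [-> ->]].
by rewrite -Eq pmulrn -mulrzA mulrC.
Qed.

Lemma char_ext (B : zmodType) (H : B * QZ -> Prop) :
  subgrp H -> (forall e, H (0, e) -> e = 0) ->
  exists chi : char B, forall b e, H (b, e) -> chi b = e.
Proof.
move=> sH H0; have gH : @pgraph int (zmodule B) (zmodule QZ) H.
  split=> //; split; first exact: sH.1.
  move=> a [x e] [y f] Hx Hy.
  apply: (subgrpD sH _ Hy); have := subgrpMz a sH Hx.
  by rewrite [_ *~ a]surjective_pairing (raddfMz fst) (raddfMz snd).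
have [h hE] := baer_ext QZ_baer gH.
have [chi chiE] := @mk_additive B QZ h (raddfD h).
by exists chi => b e He; rewrite -(hE _ _ He) -chiE.
Qed.

Lemma char_sep (B : zmodType) (X : B -> Prop) (x : B) :
  subgrp X -> ~ X x ->
  exists2 chi : char B, (forall y, X y -> chi y = 0) & chi x <> 0.
Proof.
move=> sX nXx; have [|d Xd dP] := @int_subgrp (fun n => X (x *~ n)).
  split; first by rewrite mulr0z; apply: sX.1.
  by move=> m n Xm Xn; rewrite mulrzBr; apply: sX.2.
(* [d] generates the ideal of all n with n x in [X], so the value [q] planned for x must be nonzero
   and killed by [d]. For d = 0 any nonzero q will do; d = 1 is excluded as x is not in [X]. *)
have [q qd q0] : exists2 q : QZ, q *+ d = 0 & q <> 0.
  case: d Xd {dP} => [_|[|d] Xd].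
  - by have [q _ q0] := @QZ_torsion 2 isT; exists q; rewrite ?mulr0n.
  - by case: nXx; rewrite -[x]mulr1z.
  - exact: QZ_torsion.
have [||chi chiE] := @char_ext B
  (fun p => exists2 n : int, X (p.1 - x *~ n) & p.2 = q *~ n).
- split; first by exists 0; rewrite ?mulr0z ?subrr //; apply: sX.1.
  move=> [y e] [y' e'] /= [n Xn ->] [m Xm ->]; exists (n - m); rewrite ?mulrzBr //.
  suff -> : y - y' - (x *~ n - x *~ m) = y - x *~ n - (y' - x *~ m) by apply: sX.2.
  by rewrite !opprD addrACA.
- move=> e /= [n]; rewrite sub0r => /(subgrpN sX); rewrite opprK => /dP[k ->] ->.
  by rewrite mulrC mulrzA -pmulrn qd mul0rz.
exists chi => [y Xy|]; first by apply: chiE; exists 0; rewrite mulr0z ?subr0.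
rewrite (chiE x q); first exact: q0.
by exists 1; rewrite !mulr1z ?subrr //; apply: sX.1.
Qed.

Lemma char_sep0 (B : zmodType) (x : B) : x <> 0 -> exists chi : char B, chi x <> 0.
Proof.
move=> x0; have [||chi _ chix] := @char_sep B (eq 0) x; last by exists chi.
- by split=> // _ _ <- <-; rewrite subrr.
- by move=> Ex; apply: x0.
Qed.

Definition single (I : eqType) (B : zmodType) (i : I) (b : B) : I -> B :=
  fun j => if j == i then b else 0.

Lemma sum_single (I : finType) (B : zmodType) (mu : I -> B) :
  \sum_i single i (mu i) = mu.
Proof.
apply/funext => j; rewrite fct_sumE (bigD1 j) //= /single eqxx big1 ?addr0 //.
by move=> i; rewrite eq_sym => /negPf ->.
Qed.

Lemma char_family (I : finType) (B : zmodType) (chi : char (I -> B)) :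
  exists y : I -> char B, forall mu, chi mu = \sum_i y i (mu i).
Proof.
have /choice[y yE] i : exists y : char B, forall b, y b = chi (single i b).
  have [b b'|y yE] := @mk_additive B QZ (fun b => chi (single i b)).
    rewrite -raddfD; congr (chi _); apply/funext => j.
    by rewrite /single /GRing.add /=; case: ifP; rewrite ?addr0.
  by exists y => b; apply: yE.
exists y => mu; under eq_bigr do rewrite yE.
by rewrite -raddf_sum sum_single.
Qed.

(** This is how unknowns in a character module are found below: a linear system for the [y i]
    prescribes one character of a finite power on a subgroup, and its consistency is the second
    hypothesis. *)
Lemma char_ext_family (I : finType) (B : zmodType) (H : (I -> B) * QZ -> Prop) :
  subgrp H -> (forall e, H (0, e) -> e = 0) ->
  exists y : I -> char B, forall mu e, H (mu, e) -> \sum_i y i (mu i) = e.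
Proof.
move=> sH H0; have [chi chiE] := char_ext sH H0; have [y yE] := char_family chi.
by exists y => mu e /chiE <-.
Qed.

Lemma char_sep_family (I : finType) (B : zmodType) (X : (I -> B) -> Prop) mu :
  subgrp X -> ~ X mu ->
  exists2 y : I -> char B, (forall nu, X nu -> \sum_i y i (nu i) = 0) &
    \sum_i y i (mu i) <> 0.
Proof.
move=> sX nX; have [chi chi0 chimu] := char_sep sX nX; have [y yE] := char_family chi.
by exists y => [nu /chi0|]; rewrite -yE.
Qed.

(** * Injective modules and embeddings into them *)

Section Coinduced.

Variable S : pzRingType.

(* Hom_Z(S, Q/Z) *)
Definition coind : lmodType S := charr ((S^c)^o).

Lemma coindE (s : S) (f : coind) (t : S) : char_fun (s *: f) t = char_fun f (t * s).
Proof. by []. Qed.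

(** Coinduction is right adjoint to forgetting the scalars; [chi] is recovered from [h] by
    evaluation at 1. *)
Lemma coind_map (V : lmodType S) (chi : char V) :
  exists h : {linear V -> coind}, forall v (t : S), char_fun (h v) t = chi (t *: v).
Proof.
have /choice[f fE] (v : V) : exists f : coind, forall t : S, char_fun f t = chi (t *: v).
  have [t t'|f fE] := @mk_additive ((S^c)^o) QZ (fun t => chi ((t : S) *: v)).
    by rewrite scalerDl raddfD.
  by exists f => t; apply: fE.
have [a x y|h hE] := @mk_linear S V coind f.
  apply: charP => t; rewrite [LHS]fE scalerDr raddfD scalerA.
  exact: (esym (congr2 +%R (fE x ((t : S) * a)) (fE y t))).
by exists h => v t; rewrite hE fE.
Qed.

(** By adjunction from the injectivity of Q/Z: evaluating the partial map at 1 gives a partial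
    character of [S], and [e0] is an extension of it. *)
Lemma coind_baer : baer coind.
Proof.
move=> H gH.
have [||e0 e0E] := @char_ext ((S^c)^o)
  (fun p => exists2 e : coind, H (p.1, e) & p.2 = char_fun e (1 : S)).
- split; first by exists 0 => //; apply: (submod0 gH.1).
  move=> [s e] [s' e'] /= [f Hf ->] [f' Hf' ->].
  by exists (f - f') => //; apply: (submodB gH.1 Hf Hf').
- by move=> e /= [f /gH.2 -> ->].
exists e0 => s e Hs; apply: charP => t; rewrite coindE.
rewrite (e0E _ (char_fun e t)) //; exists ((t : S) *: e); last by rewrite coindE mul1r.
exact: (submodZ gH.1 t Hs).
Qed.

(** V / P embeds into a power of the injective [coind], with one useful coordinate for each
    character killing [P]; the others are 0. Indexing by all of [char V] keeps the target
    independent of [P]. *)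
Lemma quotient_embedding (V : lmodType S) (P : V -> Prop) : submod P ->
  exists q : {linear V -> (char V -> coind)}, forall x, q x = 0 <-> P x.
Proof.
move=> sP.
have /choice[h hE] (chi : char V) : exists h : {linear V -> coind},
    (forall x, P x -> h x = 0) /\
    ((forall x, P x -> chi x = 0) -> forall v (t : S), char_fun (h v) t = chi (t *: v)).
  have [kchi|nk] := pselect (forall x, P x -> chi x = 0); last by exists \0.
  have [h hE] := coind_map chi; exists h; split=> // x Px.
  by apply: charP => t; rewrite hE kchi //; apply: submodZ.
have [a x y|q qE] := @mk_linear S V (char V -> coind) (fun v chi => h chi v).
  by apply/funext => chi; rewrite linearP.
exists q => x; rewrite qE; split=> [q0|Px]; last first.
  by apply/funext => chi; rewrite (hE chi).1.
apply: contrapT => nPx; have [chi chi0 []] := char_sep (submod_grp sP) nPx.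
have := congr1 (fun f => char_fun (f chi) (1 : S)) q0.
by rewrite (hE chi).2 // scale1r.
Qed.

(** The quotient is realized as the image of [V] under the embedding of V / P. *)
Lemma quotient_exists (V : lmodType S) (P : V -> Prop) : submod P ->
  exists (Q : lmodType S) (q : {linear V -> Q}),
    (forall y, exists x, q x = y) /\ (forall x, q x = 0 <-> P x).
Proof.
move=> sP; have [q qE] := quotient_embedding sP.
have sI : submod (fun y => exists x, q x = y).
  split; first by exists 0; rewrite linear0.
  by move=> a _ _ [x <-] [y <-]; exists (a *: x + y); rewrite linearP.
have /choice[f fE] x : exists y : subm sI, \val y = q x by apply: subm_ex; exists x.
have [a x y|h hE] := @mk_linear S V (subm sI) f.
  by apply: val_inj; rewrite linearP /= !fE linearP.
exists (subm sI), h; split=> [y|x].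
  by have [x Ex] := submP y; exists x; apply: val_inj; rewrite hE fE.
rewrite -qE hE -fE; split=> [->|f0]; first by rewrite linear0.
by apply: val_inj; rewrite f0 linear0.
Qed.

End Coinduced.

Lemma injective_embedding (S : pzRingType) (V : lmodType S) :
  exists (E : lmodType S) (i : {linear V -> E}), baer E /\ injective i.
Proof.
have [|q qE] := @quotient_embedding S V (eq 0).
  by split=> // a _ _ <- <-; rewrite scaler0 addr0.
exists (char V -> coind S), q; split; first exact/baer_fun/coind_baer.
move=> x y /eqP; rewrite -subr_eq0 -linearB => /eqP/qE/esym/eqP.
by rewrite subr_eq0 => /eqP.
Qed.

(** * Flatness *)

Section TensorCharacters.

Variable R : pzRingType.

Lemma tensor_ind (L : lmodType R^c) (M : lmodType R) (P : tensor L M -> Prop) :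
  subgrp P -> (forall a m, P (tens a m)) -> forall x, P x.
Proof.
move=> sP Pt x; rewrite -[x](@reprK _ {ideal_quot (@tensor_relb R L M)}).
set y := repr _; rewrite -(freeg_sumE y) raddf_sum.
elim/big_ind: _ => [|? ? |[a m] _]; first exact: sP.1.
  exact: subgrpD.
have -> : << coeff (a, m) y *g (a, m) >> =
    << (a, m) >> *~ coeff (a, m) y :> {freeg (L * M)%type / int}.
  by rewrite freegU_mulz intz.
by rewrite raddfMz; apply: subgrpMz (Pt a m).
Qed.

(** Hom-tensor adjunction for Q/Z; together with [balanced_charl] it trades maps M -> N^+ for maps N
    -> M^+. *)
Lemma balanced_charr (N : lmodType R^c) (M : lmodType R) (b : N -> M -> QZ) :
  balanced b -> exists f : {linear M -> charr N}, forall m a, char_fun (f m) a = b a m.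
Proof.
move=> [bDl bDr bZ].
have /choice[f fE] m : exists f : charr N, forall a, char_fun f a = b a m.
  by have [a a'|f fE] := @mk_additive N QZ (b^~ m); [apply: bDl | exists f].
have [r x y|h hE] := @mk_linear R M (charr N) f.
  apply: charP => a; rewrite [LHS]fE bDr -bZ.
  exact: (esym (congr2 +%R (fE x ((r : R^c) *: a)) (fE y a))).
by exists h => m a; rewrite hE fE.
Qed.

Lemma balanced_charl (N : lmodType R^c) (M : lmodType R) (b : N -> M -> QZ) :
  balanced b -> exists f : {linear N -> charl M}, forall a m, char_fun (f a) m = b a m.
Proof.
move=> [bDl bDr bZ].
have /choice[f fE] a : exists f : charl M, forall m, char_fun f m = b a m.
  by have [m m'|f fE] := @mk_additive M QZ (b a); [apply: bDr | exists f].
have [r x y|h hE] := @mk_linear R^c N (charl M) f.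
  apply: charP => m; rewrite [LHS]fE bDl bZ.
  exact: (esym (congr2 +%R (fE x ((r : R) *: m)) (fE y m))).
by exists h => m a; rewrite hE fE.
Qed.

Lemma charr_balanced (N : lmodType R^c) (M : lmodType R) (f : {linear M -> charr N}) :
  balanced (fun a m => char_fun (f m) a).
Proof.
by split=> [a a' m|a m m'|r a m]; rewrite ?raddfD ?linearZ //=.
Qed.

Lemma charl_balanced (N : lmodType R^c) (M : lmodType R) (f : {linear N -> charl M}) :
  balanced (fun a m => char_fun (f a) m).
Proof.
by split=> [a a' m|a m m'|r a m]; rewrite ?raddfD ?linearZ //=.
Qed.

Lemma charr_of_charl (N : lmodType R^c) (M : lmodType R) (f : {linear N -> charl M}) :
  exists g : {linear M -> charr N}, forall m a, char_fun (g m) a = char_fun (f a) m.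
Proof. exact: balanced_charr (charl_balanced f). Qed.

Lemma charl_of_charr (N : lmodType R^c) (M : lmodType R) (f : {linear M -> charr N}) :
  exists g : {linear N -> charl M}, forall a m, char_fun (g a) m = char_fun (f m) a.
Proof. exact: balanced_charl (charr_balanced f). Qed.

Lemma charr_dual (N K : lmodType R^c) (i : {linear N -> K}) :
  exists h : {linear charr K -> charr N},
    forall f a, char_fun (h f) a = char_fun f (i a).
Proof.
apply: (@balanced_charr N (charr K) (fun a f => char_fun f (i a))).
by split=> [a a' m|a m m'|r a m]; rewrite ?raddfD ?linearZ //=.
Qed.

Lemma charl_dual (N K : lmodType R) (i : {linear N -> K}) :
  exists h : {linear charl K -> charl N},
    forall f a, char_fun (h f) a = char_fun f (i a).
Proof.
apply: (@balanced_charl (charl K) N (fun f a => char_fun f (i a))).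
by split=> [a a' m|a m m'|r a m]; rewrite ?raddfD ?linearZ //=.
Qed.

Lemma charr_eval (N : lmodType R) :
  exists h : {linear N -> charr (charl N)},
    forall x f, char_fun (h x) f = char_fun f x.
Proof.
apply: (@balanced_charr (charl N) N (fun f a => char_fun f a)).
by split=> [a a' m|a m m'|r a m]; rewrite ?raddfD ?linearZ //=.
Qed.

(** The characters of the tensor product of N and M are the maps M -> N^+. As Q/Z is an injective
    cogenerator, a homomorphism of groups is injective iff every character extends along it. *)
Lemma tensor_map_injP (N K : lmodType R^c) (M : lmodType R) (i : {linear N -> K}) :
  injective (tensor_map M i) <->
  forall f : {linear M -> charr N}, exists h : {linear M -> charr K},
    forall m a, char_fun (h m) (i a) = char_fun (f m) a.
Proof.
have tB := tensor_map_zmod_morphism (M := M) i.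
have t0 : tensor_map M i 0 = 0 by rewrite -[X in tensor_map M i X](subrr 0) tB subrr.
split=> [inj_t f|ext x y Exy].
  have bf := charr_balanced f; set b := (fun a m => _) in bf.
  have lB := tensor_lift_zmod_morphism bf.
  have l0 : tensor_lift b 0 = 0 by rewrite -[X in tensor_lift b X](subrr 0) lB subrr.
  have [||chi chiE] := @char_ext (tensor K M)
    (fun p => exists2 z, p.1 = tensor_map M i z & p.2 = tensor_lift b z).
  - split; first by exists 0.
    by move=> [? ?] [? ?] /= [z -> ->] [z' -> ->]; exists (z - z'); rewrite ?tB ?lB.
  - by move=> e [z /=]; rewrite -t0 => /inj_t <- ->.
  have [tDl tDr tZ] := tens_balanced K M.
  have [|h hE] := @balanced_charr K M (fun k m => chi (tens k m)).
    by split=> *; rewrite ?tDl ?tDr ?tZ ?raddfD.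
  exists h => m a; rewrite hE; apply: chiE; exists (tens a m).
    by rewrite tensor_map_tens.
  by rewrite tensor_lift_tens.
apply/eqP; rewrite -subr_eq0; apply/eqP; apply: contrapT => /char_sep0[chi]; apply.
have z0 : tensor_map M i (x - y) = 0 by rewrite tB Exy subrr.
move: (x - y) z0 => z z0.
have [tDl tDr tZ] := tens_balanced N M.
have [|f fE] := @balanced_charr N M (fun k m => chi (tens k m)).
  by split=> *; rewrite ?tDl ?tDr ?tZ ?raddfD.
have [h hE] := ext f; have bh := charr_balanced h; set b := (fun a m => _) in bh.
have lB := tensor_lift_zmod_morphism bh.
have l0 : tensor_lift b 0 = 0 by rewrite -[X in tensor_lift b X](subrr 0) lB subrr.
suff <- : tensor_lift b (tensor_map M i z) = chi z by rewrite z0.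
move: z {z0}; apply: tensor_ind => [|a m].
  split; first by rewrite t0 l0 raddf0.
  by move=> z z' Ez Ez'; rewrite tB lB Ez Ez' raddfB.
by rewrite tensor_map_tens tensor_lift_tens // /b hE fE.
Qed.

(** Lambek's theorem. By adjunction, flatness of [F] says that maps into F^+ extend along
    injections. Applied to the inclusion of a right ideal in R, this is Baer's criterion for F^+. *)
Lemma flat_baer (F : lmodType R) : flat F <-> baer (charl F).
Proof.
split=> [flF H gH|bF A B i inji]; last first.
  apply/tensor_map_injP => f; have [g gE] := charl_of_charr f.
  have [h hE] := baer_lift g bF inji; have [k kE] := charr_of_charl h.
  by exists k => m a; rewrite kE hE gE.
have sD : submod (fun s : (R^c)^o => exists e, H (s, e)).
  split; first by exists 0; apply: (submod0 gH.1).
  by move=> a x y [e He] [e' He']; exists (a *: e + e'); apply: (gH.1.2 a _ _ He He').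
have [g gE] : exists g : {linear subm sD -> charl F}, forall s, H (\val s, g s).
  have /choice[g gE] (s : subm sD) : exists e, H (\val s, e) by exact: (submP s).
  have [a x y|h hE] := @mk_linear R^c (subm sD) (charl F) g.
    apply: (pgraph_fun gH (gE _)); rewrite linearP; exact: (gH.1.2 a _ _ (gE x) (gE y)).
  by exists h => s; rewrite hE.
have [f fE] := charr_of_charl g.
have /tensor_map_injP/(_ f)[h hE] := flF _ _ (\val : {linear subm sD -> (R^c)^o}) val_inj.
have [k kE] := charl_of_charr h.
exists (k 1) => s e Hs; have [|s' Es] := @subm_ex _ _ _ sD s; first by exists e.
have -> : e = g s' by apply: (pgraph_fun gH Hs); rewrite -Es.
rewrite -linearZ; apply: charP => x; rewrite -fE -hE kE /= Es.
by rewrite /GRing.scale /= mulr1.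
Qed.

End TensorCharacters.

Section CatFun.

Variables (T : Type) (n m : nat) (f : 'I_n -> T) (g : 'I_m -> T).

Definition cat_fun (i : 'I_(n + m)) : T :=
  match fintype.split i with inl a => f a | inr b => g b end.

Lemma cat_funl i : cat_fun (lshift m i) = f i.
Proof. by rewrite /cat_fun (unsplitK (inl i)). Qed.

Lemma cat_funr i : cat_fun (rshift n i) = g i.
Proof. by rewrite /cat_fun (unsplitK (inr i)). Qed.

Lemma cat_funP (P : T -> Prop) :
  (forall i, P (f i)) -> (forall i, P (g i)) -> forall i, P (cat_fun i).
Proof. by move=> Pf Pg i; rewrite /cat_fun; case: (fintype.split i). Qed.

End CatFun.

Lemma charl_sum (R : pzRingType) (F : lmodType R) (I : Type) (r : seq I)
    (f : I -> charl F) x :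
  char_fun (\sum_(i <- r) f i) x = \sum_(i <- r) char_fun (f i) x.
Proof. by elim/big_rec2: _ => // i y e _ <-. Qed.

(** * The equational criterion for flatness *)

Section EquationalFlatness.

Variable R : pzRingType.

(* For submodules P <= Q of V: the equational criterion for flatness of Q / P. *)
Definition qflat (V : lmodType R) (P Q : V -> Prop) : Prop :=
  forall n (r : 'I_n -> R) (x : 'I_n -> V),
    (forall i, Q (x i)) -> P (\sum_i r i *: x i) ->
  exists m (A : 'I_n -> 'I_m -> R) (y : 'I_m -> V),
    [/\ forall j, Q (y j),
        forall j, \sum_i r i * A i j = 0 &
        forall i, P (x i - \sum_j A i j *: y j)].

Definition eqflat (V : lmodType R) : Prop :=
  forall n (r : 'I_n -> R) (x : 'I_n -> V), \sum_i r i *: x i = 0 ->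
  exists m (A : 'I_n -> 'I_m -> R) (y : 'I_m -> V),
    (forall j, \sum_i r i * A i j = 0) /\ (forall i, x i = \sum_j A i j *: y j).

(** For a partial map r |-> f on R, the character sought must send sum r_i x_i to sum f_i(x_i). This
    is well defined: if sum r_i x_i = 0, write x = A y with r A = 0; then sum f_i A_ij is the image
    of sum r_i A_ij = 0 for each j. *)
Lemma eqflat_baer (F : lmodType R) : eqflat F -> baer (charl F).
Proof.
move=> flF H gH.
pose Th (p : F * QZ) := exists n (r : 'I_n -> R) (f : 'I_n -> charl F) (x : 'I_n -> F),
  [/\ forall i, H (r i, f i), p.1 = \sum_i r i *: x i & p.2 = \sum_i char_fun (f i) (x i)].
have [||psi psiE] := @char_ext F Th.
- split.
    exists 0%N, (fun=> 0), (fun=> 0), (fun=> 0); split=> [[]||] //; by rewrite big_ord0.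
  move=> [? ?] [? ?] [n [r [f [x [Hr /= -> ->]]]]] [n' [r' [f' [x' [Hr' /= -> ->]]]]].
  exists (n + n')%N, (cat_fun r r'), (cat_fun f f'), (cat_fun x (fun i => - x' i)).
  split=> [i||].
  - by rewrite /cat_fun; case: (fintype.split i).
  - rewrite big_split_ord /=; congr (_ + _); rewrite -?sumrN; apply: eq_bigr => i _.
      by rewrite !cat_funl.
    by rewrite !cat_funr scalerN.
  - rewrite big_split_ord /=; congr (_ + _); rewrite -?sumrN; apply: eq_bigr => i _.
      by rewrite !cat_funl.
    by rewrite !cat_funr raddfN.
- move=> _ [n [r [f [x [Hr /= /esym rx0 ->]]]]].
  have [m [A [y [rA0 xE]]]] := flF n r x rx0.
  under eq_bigr => i _ do rewrite xE raddf_sum.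
  rewrite exchange_big big1 //= => j _.
  have H0 : H (\sum_i r i * A i j, \sum_i (A i j : R^c) *: f i).
    have := submod_sum gH.1 (index_enum 'I_n)
      (fun i => submodZ gH.1 (A i j : R^c) (Hr i)).
    by rewrite [\sum_(i <- _) _]surjective_pairing (raddf_sum fst) (raddf_sum snd).
  rewrite rA0 in H0; have := gH.2 _ H0 => /(congr1 (fun e => char_fun e (y j))).
  by rewrite charl_sum.
exists psi => s e Hs; apply: charP => x.
symmetry; apply: psiE; exists 1%N, (fun=> s), (fun=> e), (fun=> x).
by split=> //=; rewrite big_ord1.
Qed.

(** If x has no factorization, characters chi_i separate it from the vectors [Z] that have one.
    Since c y is in [Z] whenever r c = 0, the assignment r_i |-> chi_i is a partial map on R, so
    chi_i = r_i psi by injectivity and sum chi_i(x_i) = psi(sum r_i x_i) = 0, a contradiction. *)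
Lemma baer_eqflat (F : lmodType R) : baer (charl F) -> eqflat F.
Proof.
move=> bF n r x rx0.
pose Z (z : 'I_n -> F) := exists m (A : 'I_n -> 'I_m -> R) (y : 'I_m -> F),
    (forall j, \sum_i r i * A i j = 0) /\ (forall i, z i = \sum_j A i j *: y j).
have sZ : subgrp Z.
  split; first by exists 0%N, (fun _ => fun=> 0), (fun=> 0); split=> [[]|i] //; rewrite big_ord0.
  move=> z z' [m [A [y [rA zE]]]] [m' [A' [y' [rA' zE']]]].
  exists (m + m')%N, (fun i => cat_fun (A i) (A' i)), (cat_fun y (fun i => - y' i)).
  split=> [j|i].
    rewrite /cat_fun; case: (fintype.split j) => k; [exact: rA | exact: rA'].
  rewrite big_split_ord /= [LHS]/GRing.add /= zE [(- z') i]/GRing.opp /= zE' -sumrN.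
  by congr (_ + _); apply: eq_bigr => j _; rewrite ?cat_funl ?cat_funr ?scalerN.
apply: contrapT => nZx; have [chi chi0 []] := char_sep_family sZ nZx.
have [|psi psiE] := bF (fun p => exists2 c : 'I_n -> R, p.1 = \sum_i r i * c i
    & p.2 = \sum_i (c i : R^c) *: (chi i : charl F)).
  split.
    split.
      exists (fun=> 0) => /=; first by rewrite big1 // => i _; rewrite mulr0.
      by rewrite big1 // => i _; rewrite scale0r.
    move=> a [? ?] [? ?] /= [c -> ->] [c' -> ->]; exists (fun i => c i * a + c' i).
      transitivity ((\sum_i r i * c i) * a + \sum_i r i * c' i) => //.
      rewrite mulr_suml -big_split /=.
      by apply: eq_bigr => i _; rewrite mulrDr mulrA.
    rewrite scaler_sumr -big_split /=; apply: eq_bigr => i _.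
    by rewrite scalerA -scalerDl.
  move=> e [c /= /esym rc ->]; apply: charP => y; rewrite charl_sum.
  have := chi0 (fun i => c i *: y); apply.
  exists 1%N, (fun i => fun=> c i), (fun=> y); split=> [j|i] //.
  by rewrite big_ord1.
have chiE i : (chi i : charl F) = (r i : R^c) *: psi.
  apply: psiE; exists (fun j => (j == i)%:R).
    by rewrite (bigD1 i) //= eqxx mulr1 big1 ?addr0 // => j /negPf ->; rewrite mulr0.
  rewrite (bigD1 i) //= eqxx scale1r big1 ?addr0 // => j /negPf ->; exact: scale0r.
under eq_bigr => i _ do rewrite chiE.
rewrite -[RHS](raddf0 (psi : char F)) -rx0 raddf_sum; exact: eq_bigr.
Qed.

Lemma flat_eqflat (F : lmodType R) : flat F <-> eqflat F.
Proof.
by split=> [/flat_baer/baer_eqflat|/eqflat_baer/flat_baer].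
Qed.
End EquationalFlatness.

(** * Flat precovers *)

Section Terms.

Variable R : pzRingType.

(* In a module F with a submodule D, (t_sol r t) names a solution modulo D of the
   equation r x = t, and (t_fac r t) names the vector y of a factorization
   t = A y modulo D with r A = 0, given r t = 0 modulo D. Together with an element,
   the values of all terms thus form a submodule of F / D that is pure and flat, and
   whose size is bounded in terms of R only. *)
Inductive term : Type :=
| t_zero
| t_gen
| t_add (t u : term)
| t_scale (r : R) (t : term)
| t_sol n (r : 'I_n -> R) (t : term) (k : 'I_n)
| t_fac n (r : 'I_n -> R) (t : 'I_n -> term) (k : nat).

HB.instance Definition _ := gen_eqMixin term.
HB.instance Definition _ := gen_choiceMixin term.

Definition term_hom (V : lmodType R) (h : term -> V) : Prop :=
  [/\ h t_zero = 0, forall t u, h (t_add t u) = h t + h u &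
      forall r t, h (t_scale r t) = r *: h t].

(** Equality in the free module, imposed through all interpretations in modules: each module axiom
    holds in the quotient because it holds in every [V]. *)
Definition term_eq (t u : term) : bool :=
  `[< forall (V : lmodType R) (h : term -> V), term_hom h -> h t = h u >].

Lemma term_eq_refl : reflexive term_eq.
Proof. by move=> t; apply/asboolP. Qed.

Lemma term_eq_sym : symmetric term_eq.
Proof. by move=> t u; apply/asboolP/asboolP => e V h /e. Qed.

Lemma term_eq_trans : transitive term_eq.
Proof. by move=> u t w /asboolP e /asboolP e'; apply/asboolP => V h hh; rewrite e ?e'. Qed.

Canonical term_equiv := EquivRel term_eq term_eq_refl term_eq_sym term_eq_trans.

(* The free module on the terms that are neither sums nor multiples. *)
Definition fterm : Type := {eq_quot term_equiv}%qT.

HB.instance Definition _ := Choice.on fterm.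

Definition fterm_pi (t : term) : fterm := (\pi_({eq_quot term_equiv}) t)%qT.
Definition fterm_repr (x : fterm) : term := repr (x : {eq_quot term_equiv}%qT).

Lemma fterm_reprK x : fterm_pi (fterm_repr x) = x.
Proof. exact: reprK. Qed.

Lemma fterm_hom (V : lmodType R) (h : term -> V) t :
  term_hom h -> h (fterm_repr (fterm_pi t)) = h t.
Proof.
move=> hh; have /eqmodP/asboolP : fterm_pi (fterm_repr (fterm_pi t)) = fterm_pi t.
  exact: fterm_reprK.
exact.
Qed.

Lemma fterm_pi_eq t u :
  (forall (V : lmodType R) (h : term -> V), term_hom h -> h t = h u) ->
  fterm_pi t = fterm_pi u.
Proof. by move=> e; apply/eqmodP/asboolP. Qed.

Definition fterm_add x y := fterm_pi (t_add (fterm_repr x) (fterm_repr y)).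
Definition fterm_scale r x := fterm_pi (t_scale r (fterm_repr x)).

Ltac fterm_axiom :=
  let V := fresh "V" in let h := fresh "h" in let hh := fresh "hh" in
  let h0 := fresh "h0" in let hD := fresh "hD" in let hZ := fresh "hZ" in
  apply: fterm_pi_eq => V h hh; have [h0 hD hZ] := hh;
  rewrite ?(hD, hZ, fterm_hom _ hh) ?h0.

Lemma fterm_addA : associative fterm_add.
Proof. by move=> x y z; fterm_axiom; rewrite addrA. Qed.
Lemma fterm_addC : commutative fterm_add.
Proof. by move=> x y; fterm_axiom; rewrite addrC. Qed.
Lemma fterm_add0 : left_id (fterm_pi t_zero) fterm_add.
Proof. by move=> x; rewrite -[RHS]fterm_reprK; fterm_axiom; rewrite add0r. Qed.
Lemma fterm_addN : left_inverse (fterm_pi t_zero) (fterm_scale (-1)) fterm_add.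
Proof. by move=> x; fterm_axiom; rewrite scaleN1r addNr. Qed.

HB.instance Definition _ :=
  GRing.isZmodule.Build fterm fterm_addA fterm_addC fterm_add0 fterm_addN.

Lemma fterm_scaleA a b x : fterm_scale a (fterm_scale b x) = fterm_scale (a * b) x.
Proof. by fterm_axiom; rewrite scalerA. Qed.
Lemma fterm_scale1 : left_id 1 fterm_scale.
Proof. by move=> x; rewrite -[RHS]fterm_reprK; fterm_axiom; rewrite scale1r. Qed.
Lemma fterm_scaleDr : right_distributive fterm_scale +%R.
Proof. by move=> a x y; fterm_axiom; rewrite scalerDr. Qed.
Lemma fterm_scaleDl x : {morph fterm_scale^~ x : a b / a + b}.
Proof. by move=> a b; fterm_axiom; rewrite scalerDl. Qed.

HB.instance Definition _ := GRing.Zmodule_isLmodule.Build R fterm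
  fterm_scaleA fterm_scale1 fterm_scaleDr fterm_scaleDl.

Lemma fterm_lift (V : lmodType R) (h : term -> V) : term_hom h ->
  exists f : {linear fterm -> V}, forall t, f (fterm_pi t) = h t.
Proof.
move=> hh; have [h0 hD hZ] := hh.
have [a x y|f fE] := @mk_linear R fterm V (fun x => h (fterm_repr x)).
  by rewrite [LHS](fterm_hom _ hh) hD (fterm_hom _ hh) hZ.
by exists f => t; rewrite fE fterm_hom.
Qed.

End Terms.

(** * Formal solutions of lifting problems *)

Section Nodes.

Variables (R : pzRingType) (N : lmodType R).

Local Notation G := (fterm R).

(* A node is a lifting problem: extend to G, over v : G -> N, the map on the
   submodule X which sends g to the sum over k < len g of the value at
   (ug g k) of the solution of the problem (ut g k). *)
Inductive node : Type :=
  Node (X : G -> Prop) (len : G -> nat) (ut : forall g, 'I_(len g) -> node)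
       (ug : forall g, 'I_(len g) -> G) (v : {linear G -> N}).

Definition child (u t : node) : Prop :=
  let: Node _ _ ut _ _ := t in exists g k, u = ut g k.

Inductive subnode : node -> node -> Prop :=
| subnode_refl t : subnode t t
| subnode_step t u w : child u w -> subnode t u -> subnode t w.

Lemma subnode_inv t w : subnode t w -> t = w \/ exists2 u, child u w & subnode t u.
Proof. by case=> [?|? u ? ? ?]; [left | right; exists u]. Qed.

Lemma subnode_trans t u w : subnode t u -> subnode u w -> subnode t w.
Proof.
move=> tu uw; elim: uw tu => // {}u u' {}w cu' _ IH tu.
by apply: (subnode_step cu'); apply: IH tu.
Qed.

Lemma subnode_irrefl u t : child u t -> ~ subnode t u.
Proof.
elim: t u => X len ut IH ug v u; set t := Node _ _ _ _ => -[g [k ->]].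
have ct : child (ut g k) t by exists g, k.
move=> /subnode_inv[E|[u' cu' H']].
  by apply: (IH g k (ut g k)); [rewrite -{2}E | apply: subnode_refl].
by apply: (IH g k u' cu'); apply: subnode_trans H'; apply: subnode_step ct (subnode_refl _).
Qed.

(** The component in [N] carries the map of the future precover; the other coordinates keep the
    solutions of different nodes apart. *)
Definition ambient : lmodType R := (N * (node * char G -> coind R))%type.

(* The coordinates (t, chi) of a solution of t are reserved to t: they ensure
   that a solution only satisfies the relations which it has to satisfy. *)
Definition solves (X : G -> Prop) (b : G -> ambient) (v : {linear G -> N})
    (t : node) (w : {linear G -> ambient}) : Prop :=
  [/\ forall x, X x -> w x = b x,
      forall g, (w g).1 = v g,
      forall u chi, u <> t -> (forall x, X x -> (b x).2 (u, chi) = 0) ->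
        forall g, (w g).2 (u, chi) = 0 &
      forall chi : char G, (forall x, X x -> chi x = 0) ->
        forall g (s : R), char_fun ((w g).2 (t, chi)) s = chi (s *: g)].

Definition flat_solution X b v t w : Prop :=
  [/\ submod X, qflat X (fun=> True) & solves X b v t w].

(** The recursion first solves the children, whose solutions make up the base map [b]. A node
    without a solution gets the zero map, which adds nothing to the span. *)
Fixpoint node_sol (t : node) : {linear G -> ambient} :=
  let: Node X len ut ug v := t in
  let b g := \sum_(k < len g) node_sol (@ut g k) (@ug g k) in
  match pselect (exists w, flat_solution X b v t w) with
  | left ex => sval (cid ex)
  | right _ => \0
  end.

Definition node_base (t : node) (g : G) : ambient :=
  let: Node X len ut ug v := t in \sum_(k < len g) node_sol (@ut g k) (@ug g k).
Definition node_dom (t : node) : G -> Prop := let: Node X _ _ _ _ := t in X.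
Definition node_map (t : node) : {linear G -> N} := let: Node _ _ _ _ v := t in v.

Lemma node_solP t :
  flat_solution (node_dom t) (node_base t) (node_map t) t (node_sol t) \/
  (~ (exists w, flat_solution (node_dom t) (node_base t) (node_map t) t w)
   /\ forall g, node_sol t g = 0).
Proof.
case: t => X len ut ug v /=; case: pselect => [ex|nex]; last by right.
by left; case: (cid ex).
Qed.

Lemma node_base_snd t g u chi :
  (forall t' g', child t' t -> (node_sol t' g').2 (u, chi) = 0) ->
  (node_base t g).2 (u, chi) = 0.
Proof.
case: t => X len ut ug v /= H; rewrite (raddf_sum snd) fct_sumE big1 // => k _.
by apply: H; exists g, k.
Qed.

(** By induction the base of [t] vanishes at (u, chi), as [u] does not occur in any child; the third
    clause of [solves] passes this on to the solution. *)
Lemma node_sol_coord t u chi g : ~ subnode u t -> (node_sol t g).2 (u, chi) = 0.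
Proof.
move: t g; elim=> X len ut IH ug v g; set t := Node _ _ _ _ => nsub.
have [[_ _ [_ _ w0 _]]|[_ ->]] := node_solP t; last by [].
apply: w0 => [E|x _]; first by apply: nsub; rewrite E; apply: subnode_refl.
apply: node_base_snd => t' g' ct'; case: (ct') => g0 [k E]; rewrite E.
by apply: IH; rewrite -E => H; apply: nsub; apply: subnode_step ct' H.
Qed.

Inductive nspan (D : node -> Prop) : ambient -> Prop :=
| nspan0 : nspan D 0
| nspanD t g p : D t -> nspan D p -> nspan D (node_sol t g + p).

Lemma nspan_submod D : submod (nspan D).
Proof.
split=> [|a x y Dx Dy]; first exact: nspan0.
elim: Dx => [|t g p Dt _ IH]; first by rewrite scaler0 add0r.
by rewrite scalerDr -addrA -linearZ; apply: nspanD.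
Qed.

Lemma nspan_node_sol (D : node -> Prop) t g : D t -> nspan D (node_sol t g).
Proof. by move=> Dt; rewrite -[node_sol t g]addr0; apply: nspanD => //; apply: nspan0. Qed.

Lemma nspan_coord (D : node -> Prop) t chi p :
  (forall u, D u -> ~ subnode t u) -> nspan D p -> p.2 (t, chi) = 0.
Proof.
move=> nD; elim=> // u g {}p Du _ IH.
transitivity ((node_sol u g).2 (t, chi) + p.2 (t, chi)); first by [].
by rewrite node_sol_coord ?IH ?addr0 //; apply: nD.
Qed.

Lemma nspan_mono (D D' : node -> Prop) p :
  (forall t, D t -> D' t) -> nspan D p -> nspan D' p.
Proof.
by move=> sD; elim=> [|t g {}p Dt _ IH]; [apply: nspan0 | apply: nspanD => //; apply: sD].
Qed.

Definition eqflat_on (P : ambient -> Prop) : Prop := qflat (fun x => x = 0) P.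

(** An extension of flat by flat: if [t] has a solution, the new span modulo the old one is G / X
    with X the domain of [t], and G / X is flat; otherwise the span does not change. *)
Lemma nspan_add (D : node -> Prop) t :
  (forall u w, subnode u w -> D w -> D u) -> (forall u, child u t -> D u) -> ~ D t ->
  eqflat_on (nspan D) -> eqflat_on (nspan (fun u => D u \/ u = t)).
Proof.
move=> Dsub Dchild nDt flD.
have Dcoord p chi : nspan D p -> p.2 (t, chi) = 0.
  by apply: nspan_coord => u Du /Dsub/(_ Du).
set D' := fun u => _.
have sD' p : nspan D' p -> exists p0 g, nspan D p0 /\ p = p0 + node_sol t g.
  elim=> [|u g {}p Du _ [p0 [g0 [Dp0 ->]]]].
    by exists 0, 0; rewrite linear0 addr0; split=> //; apply: nspan0.
  case: Du => [Du|->].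
    by exists (node_sol u g + p0), g0; rewrite addrA; split=> //; apply: nspanD.
  by exists p0, (g + g0); rewrite linearD addrCA; split.
have Dmono p : nspan D p -> nspan D' p by apply: nspan_mono; left.
have Dbase g : nspan D (node_base t g).
  case: t Dchild {nDt Dcoord D' sD' Dmono} => X len ut ug v /= Dchild.
  apply: (submod_sum (nspan_submod D)) => k; apply: nspan_node_sol.
  by apply: Dchild; exists g, k.
have [[sX flX [wb wv _ wchi]]|[_ w0]] := node_solP t; last first.
  move=> n r x Dx rx0; have [] := flD n r x _ rx0.
    by move=> i; have [p0 [g [Dp0 ->]]] := sD' _ (Dx i); rewrite w0 addr0.
  by move=> m [A [y [Dy rA xE]]]; exists m, A, y; split=> // j; apply: Dmono.
set X := node_dom t in sX flX wb wchi.
move=> n r x Dx rx0.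
have /choice[p /choice[g pgE]] i := sD' _ (Dx i).
have Dp i := (pgE i).1; have xE i := (pgE i).2.
(* A character chi killing X but not sum r_i g_i can be read off at the coordinate (t, chi), where
   the old span vanishes; yet the solution at sum r_i g_i is in the old span. *)
have Xrg : X (\sum_i r i *: g i).
  apply: contrapT => nX; have [chi chi0 []] := char_sep (submod_grp sX) nX.
  have itpE : node_sol t (\sum_i r i *: g i) = - \sum_i r i *: p i.
    apply/eqP; rewrite -addr_eq0 addrC linear_sum -big_split /= -[X in _ == X]rx0.
    by apply/eqP/eq_bigr => i _; rewrite xE scalerDr linearZ.
  have := wchi _ chi0 (\sum_i r i *: g i) 1; rewrite scale1r => <-.
  rewrite itpE Dcoord //; apply: submodN; first exact: nspan_submod.
  by apply: (submod_sum (nspan_submod D)) => i; apply: (submodZ (nspan_submod D)).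
have [//|m [A [h [_ rA gE]]]] := flX n r g _ Xrg.
(* On X the solution is the base map, so subtracting A h modulo X brings each x_i into the old span
   without affecting the relation, as r A = 0. *)
have [||m' [B [z [Dz rB zE]]]] := flD n r (fun i => x i - \sum_j A i j *: node_sol t (h j)).
- move=> i; rewrite xE -addrA; apply: (submodD (nspan_submod D) (Dp i)).
  suff -> : node_sol t (g i) - \sum_j A i j *: node_sol t (h j) =
      node_base t (g i - \sum_j A i j *: h j).
    exact: Dbase.
  rewrite -wb // linearB (linear_sum (node_sol t)); congr (_ - _).
  by apply: eq_bigr => j _; rewrite linearZ.
- under eq_bigr do rewrite scalerBr.
  rewrite big_split /= rx0 add0r sumrN; apply/eqP; rewrite oppr_eq0; apply/eqP.
  under eq_bigr do rewrite scaler_sumr.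
  rewrite exchange_big big1 //= => j _.
  under eq_bigr do rewrite scalerA.
  by rewrite -scaler_suml rA scale0r.
exists (m + m')%N, (fun i => cat_fun (A i) (B i)), (cat_fun (fun j => node_sol t (h j)) z).
split=> [j|j|i].
- by apply: cat_funP => k; [apply: nspan_node_sol; right | apply: Dmono].
- by rewrite /cat_fun; case: (fintype.split j) => k; [apply: rA | apply: rB].
- rewrite big_split_ord /= opprD addrA -[RHS](zE i); congr (_ - _ - _).
    by apply: eq_bigr => j _; rewrite !cat_funl.
  by apply: eq_bigr => j _; rewrite !cat_funr.
Qed.

(** Zorn's lemma for sets of nodes closed under subnodes and with flat span. A maximal one contains
    every node, by induction: once all children of a node are in, the node can be added. *)
Lemma nspan_flat : eqflat_on (nspan (fun=> True)).
Proof.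
have [||D [Dsub flD] Dmax] := @Zorn_max node
  (fun D => (forall u w, subnode u w -> D w -> D u) /\ eqflat_on (nspan D)) (fun=> False).
- split=> // n r x Dx rx0; exists 0%N, (fun _ => fun=> 0), (fun=> 0).
  split=> [[]|[]|i] //; rewrite big_ord0 subr0.
  by elim: (Dx i) => // ? ? ? [].
- move=> F [D0 FD0] FP totF; split=> [u w uw [D FD Dw]|n r x Dx rx0].
    by exists D => //; apply: ((FP D FD).1 u w uw Dw).
  (* An element of the span over the union of the chain involves finitely many nodes, hence lies in
     the span of one member. *)
  have totU p : nspan (fun t => exists2 D, F D & D t) p -> exists2 D, F D & nspan D p.
    elim=> [|t g {}p [D FD Dt] _ [D' FD' Dp]]; first by exists D0 => //; apply: nspan0.
    have [s|s] := totF D D' FD FD'.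
      by exists D' => //; apply: nspanD => //; apply: s.
    by exists D => //; apply: nspanD => //; apply: nspan_mono Dp.
  have [D FD {}Dx] : exists2 D, F D & forall i, nspan D (x i).
    elim: n x {r rx0} Dx => [|n IHn] x Dx; first by exists D0 => // [[]].
    have [D FD Dlift] := IHn _ (fun i => Dx (fintype.lift ord0 i)).
    have [D' FD' Dp] := totU _ (Dx ord0).
    have [s|s] := totF D D' FD FD'; [exists D' => // i | exists D => // i];
      by case: (unliftP ord0 i) => [j|] -> //; apply: nspan_mono s _.
  have [m [A [y [Dy rA xE]]]] := (FP D FD).2 n r x Dx rx0.
  by exists m, A, y; split=> // j; apply: nspan_mono (Dy j) => t Dt; exists D.
suff Dall t : D t.
  by have -> : (fun=> True) = D by apply/funext => t; apply/propext; split.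
elim: t => X len ut IH ug v; set t := Node _ _ _ _; apply: contrapT => nDt.
apply: (nDt); apply: (Dmax (fun u => D u \/ u = t)); last by right.
  by move=> u; left.
have Dchild u : child u t -> D u by case=> g [k ->]; apply: IH.
split; last by apply: nspan_add.
move=> u w uw [Dw|Ew]; first by left; apply: Dsub uw Dw.
rewrite {w}Ew in uw; have [->|[u' /Dchild Du' uu']] := subnode_inv uw; first by right.
by left; apply: Dsub uu' Du'.
Qed.

End Nodes.

Section TermEval.

Variables (R : pzRingType) (V : lmodType R) (gen : V).
Variables (sol : forall n, ('I_n -> R) -> V -> 'I_n -> V)
          (fac : forall n, ('I_n -> R) -> ('I_n -> V) -> nat -> V).

Fixpoint term_eval (t : term R) : V :=
  match t with
  | t_zero => 0
  | t_gen => gen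
  | t_add t u => term_eval t + term_eval u
  | t_scale r t => r *: term_eval t
  | t_sol n r t k => sol r (term_eval t) k
  | t_fac n r ts k => fac r (fun i => term_eval (ts i)) k
  end.

Lemma term_eval_hom : term_hom term_eval.
Proof. by []. Qed.

End TermEval.

(** * The span of all solutions is a flat precover *)

Section Precovers.

Variables (R : pzRingType) (N : lmodType R).

Local Notation G := (fterm R).
Local Notation node := (node N).
Local Notation ambient := (ambient N).

(** The solution is built coordinate by coordinate: the map induced by chi at (t, chi) if chi kills
    X, zero at the other coordinates where [b] vanishes on X, and elsewhere an extension of [b] by
    injectivity of [coind]. *)
Lemma flat_solution_exists (t : node) (X := node_dom t) (b := node_base t) :
  submod X -> qflat X (fun=> True) ->
  (forall a x y, X x -> X y -> b (a *: x + y) = a *: b x + b y) ->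
  (forall x, X x -> (b x).1 = node_map t x) ->
  exists w, flat_solution X b (node_map t) t w.
Proof.
move=> sX flX bl bv.
(* [t] does not occur in its own children, so [b] leaves the coordinates reserved to [t] free. *)
have bt x chi : (b x).2 (t, chi) = 0.
  by apply: node_base_snd => t' g' ct'; apply: node_sol_coord; apply: subnode_irrefl.
have /choice[c cE] (i : node * char G) : exists c : {linear G -> coind R},
    [/\ forall x, X x -> c x = (b x).2 i,
        i.1 <> t -> (forall x, X x -> (b x).2 i = 0) -> forall g, c g = 0 &
        i.1 = t -> (forall x, X x -> i.2 x = 0) ->
          forall g (s : R), char_fun (c g) s = i.2 (s *: g)].
  have [b0|nb0] := pselect (forall x, X x -> (b x).2 i = 0).
    have [[E kchi]|nE] := pselect (i.1 = t /\ forall x, X x -> i.2 x = 0).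
      have [c cE] := coind_map i.2; exists c; split=> // x Xx; rewrite b0 //.
      by apply: charP => s; rewrite cE kchi //; apply: submodZ.
    by exists \0; split=> [x /b0||E kchi] //; case: nE.
  have [|c cE] := @baer_ext R G (coind R)
      (fun p => X p.1 /\ p.2 = (b p.1).2 i) (@coind_baer R).
    split.
      split; first split=> /=; first exact: submod0 sX.
        have := bl 0 0 0 (submod0 sX) (submod0 sX); rewrite !scale0r !add0r => ->.
        have := bl (-1) 0 0 (submod0 sX) (submod0 sX).
        by rewrite scaler0 addr0 scaleN1r addNr => ->.
      move=> a [x e] [y f] /= [Xx ->] [Xy ->]; split; first exact: sX.2.
      by rewrite bl.
    move=> e /= [_ ->].
    have := bl (-1) 0 0 (submod0 sX) (submod0 sX).
    by rewrite scaler0 addr0 scaleN1r addNr => ->.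
  exists c; split=> // [x Xx|E]; first exact: cE.
  by case: nb0 => x _; case: i E {c cE} => [u chi] /= ->.
have [a x y|w wE] := @mk_linear R G ambient (fun g => (node_map t g, fun i => c i g)).
  congr pair; first by rewrite linearP.
  by apply/funext => i /=; rewrite linearP.
exists w; split=> //; split=> [x Xx|g|u chi ut b0 g|chi kchi g s]; rewrite wE //=.
- rewrite [RHS]surjective_pairing bv //; congr pair; apply/funext => i.
  by have [-> //] := cE i.
- by have [_ -> //] := cE (u, chi).
- by have [_ _ -> //] := cE (t, chi).
Qed.

Lemma nspan_sum (D : node -> Prop) p : nspan D p ->
  exists n (ts : 'I_n -> node) (gs : 'I_n -> G), p = \sum_k node_sol (ts k) (gs k).
Proof.
elim=> [|t g {}p _ _ [n [ts [gs ->]]]].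
  by exists 0%N, (fun k : 'I_0 => False_rect _ (notF (ltn_ord k))), (fun=> 0); rewrite big_ord0.
exists n.+1, (fun k => oapp ts t (unlift ord0 k)), (fun k => oapp gs g (unlift ord0 k)).
rewrite big_ord_recl unlift_none /=; congr (_ + _).
by apply: eq_bigr => k _; rewrite liftK.
Qed.

(** The span solves its own lifting problems: values in the span are finite sums of solutions, so
    the problem posed by [u] is itself a node, whose solution is in the span. *)
Lemma nspan_lifting (X : G -> Prop) (u : G -> ambient) (v : {linear G -> N}) :
  submod X -> qflat X (fun=> True) ->
  (forall x, X x -> nspan (fun=> True) (u x)) ->
  (forall a x y, X x -> X y -> u (a *: x + y) = a *: u x + u y) ->
  (forall x, X x -> (u x).1 = v x) ->
  exists w : {linear G -> ambient},
    [/\ forall g, nspan (fun=> True) (w g), forall x, X x -> w x = u x &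
        forall g, (w g).1 = v g].
Proof.
move=> sX flX su ul uv.
pose data := {n : nat & (('I_n -> node) * ('I_n -> G))%type}.
have /choice[d dE] g : exists d : data,
    X g -> u g = \sum_k node_sol ((tagged d).1 k) ((tagged d).2 k).
  have [Xg|nXg] := pselect (X g).
    have [n [ts [gs E]]] := nspan_sum (su g Xg).
    by exists (existT (fun n => (('I_n -> node) * ('I_n -> G))%type) n (ts, gs)).
  by exists (existT (fun n => (('I_n -> node) * ('I_n -> G))%type) 0%N
    (fun k : 'I_0 => False_rect _ (notF (ltn_ord k)), fun=> 0)).
pose t : node := Node X (fun g k => (tagged (d g)).1 k) (fun g k => (tagged (d g)).2 k) v.
have tE x : X x -> node_base t x = u x by move=> /dE ->.
have [||||w0 sol] := @flat_solution_exists t.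
- exact: sX.
- exact: flX.
- by move=> a x y Xx Xy; rewrite !tE ?ul //; apply: sX.2.
- by move=> x Xx; rewrite tE // uv.
have [[_ _ [wb wv _ _]]|[[]]] := node_solP t; last by exists w0.
exists (node_sol t); split=> // [g|x Xx]; first exact: nspan_node_sol.
by rewrite wb // tE.
Qed.

Local Notation cover := (subm (nspan_submod (N := N) (fun=> True))).

Lemma cover_flat : flat cover.
Proof.
apply/flat_eqflat => n r x rx0.
have [||m [A [y [Dy rA xE]]]] := @nspan_flat R N n r (fun i => \val (x i)).
- by move=> i; apply: submP.
- by move: rx0 => /(congr1 val); rewrite linear0 linear_sum.
have /choice[z zE] j := subm_ex (nspan_submod (N := N) (fun=> True)) (Dy j).
exists m, A, z; split=> // i; apply: val_inj; apply/eqP; rewrite -subr_eq0.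
rewrite -(xE i) linear_sum; apply/eqP; congr (_ - _).
by apply: eq_bigr => j _; rewrite linearZ /= zE.
Qed.

Lemma cover_map : exists g : {linear cover -> N}, forall x, g x = (\val x).1.
Proof.
have [a x y|g gE] := @mk_linear R cover N (fun x => (\val x).1); last by exists g.
by rewrite linearP.
Qed.

Section Lift.

Variables (F : lmodType R) (f : {linear F -> N}).
Hypothesis flF : eqflat F.

(** Partial lifts of [f] with a domain D such that F / D is flat; this condition is what allows a
    further extension. *)
Definition plift (H : F * cover -> Prop) : Prop :=
  [/\ pgraph H, qflat (fun x => exists e, H (x, e)) (fun=> True) &
      forall x e, H (x, e) -> (\val e).1 = f x].

(** Terms are evaluated in [F], with [x0] for the generator and with solutions and factorizations
    modulo D. The image of G in F / D is then pure and flat, so the lift already given on the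
    preimage X of D extends to G. *)
Lemma plift_extend (H : F * cover -> Prop) (x0 : F) :
  plift H -> exists2 H' : F * cover -> Prop, plift H' &
    (forall p, H p -> H' p) /\ exists e, H' (x0, e).
Proof.
move=> [gH flH Hf]; pose D x := exists e, H (x, e).
have sD : submod D.
  split; first by exists 0; apply: (submod0 gH.1).
  by move=> a x y [e Hx] [e' Hy]; exists (a *: e + e'); apply: (gH.1.2 a _ _ Hx Hy).
have exsol n (r : 'I_n -> R) z : exists x : 'I_n -> F,
    (exists x', D (\sum_i r i *: x' i - z)) -> D (\sum_i r i *: x i - z).
  have [[x Dx]|nx] := pselect (exists x, D (\sum_i r i *: x i - z)).
    by exists x.
  by exists (fun=> 0) => /nx.
have exfac n (r : 'I_n -> R) (x : 'I_n -> F) : exists y : nat -> F,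
    D (\sum_i r i *: x i) -> exists m (A : 'I_n -> 'I_m -> R),
    (forall j, \sum_i r i * A i j = 0) /\ (forall i, D (x i - \sum_j A i j *: y j)).
  have [Dx|nDx] := pselect (D (\sum_i r i *: x i)); last by exists (fun=> 0) => /nDx.
  have [//|m [A [y [_ rA xE]]]] := flH n r x _ Dx.
  (* The length m depends on the factorization, while [t_fac] has indices in nat; hence the padding
     by 0. *)
  exists (fun k => oapp y 0 (insub k)) => _; exists m, A; split=> // i.
  by under eq_bigr do rewrite valK.
pose sol n r z := sval (cid (exsol n r z)).
have solP n r z : _ -> D _ := svalP (cid (exsol n r z)).
pose fac n r x := sval (cid (exfac n r x)).
have facP n r x : D _ -> _ := svalP (cid (exfac n r x)).
pose ev := term_eval x0 sol fac.
have [ga gaE] := fterm_lift (term_eval_hom x0 sol fac).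
have gaT (g : G) : exists t, g = fterm_pi t by exists (fterm_repr g); rewrite fterm_reprK.
pose X g := D (ga g).
have sX : submod X.
  split; first by rewrite /X linear0; apply: submod0.
  by move=> a x y Xx Xy; rewrite /X linearP; apply: sD.2.
have flX : qflat X (fun=> True).
  move=> n r g _ Xg; have /choice[t tE] i := gaT (g i).
  have evE i : ga (g i) = ev (t i) by rewrite tE gaE.
  have [|m [A [rA DA]]] := facP n r (fun i => ev (t i)).
    move: Xg; rewrite /X linear_sum.
    by under eq_bigr do rewrite linearZ /= evE.
  exists m, A, (fun j => fterm_pi (t_fac r t j)); split=> // i.
  rewrite /X linearB linear_sum evE.
  by under eq_bigr do rewrite linearZ /= gaE.
have /choice[u uE] g : exists e : cover, X g -> H (ga g, e).
  by have [[e He]|nX] := pselect (X g); [exists e | exists 0].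
have [w [sw wu wv]] : exists w : {linear G -> ambient},
    [/\ forall g, nspan (fun=> True) (w g), forall x, X x -> w x = \val (u x) &
        forall g, (w g).1 = f (ga g)].
  have [v vE] := comp_linear f ga.
  have [|||w [sw wu wv]] := @nspan_lifting X (fun g => \val (u g)) v sX flX.
  - by move=> x _; apply: submP.
  - move=> a x y Xx Xy; rewrite -linearP; congr (\val _).
    apply: (pgraph_fun gH (uE _ _)); first exact: sX.2.
    rewrite linearP; exact: (gH.1.2 a _ _ (uE x Xx) (uE y Xy)).
  - by move=> x Xx; rewrite vE; apply: Hf; apply: uE.
  by exists w; split=> // g; rewrite wv vE.
have /choice[w' w'E] g := subm_ex (nspan_submod (N := N) (fun=> True)) (sw g).
have w'l a x y : w' (a *: x + y) = a *: w' x + w' y.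
  by apply: val_inj; rewrite linearP /= !w'E linearP.
have [{w'l}wl wlE] := mk_linear w'l.
have Hw x : X x -> H (ga x, wl x).
  move=> Xx; suff -> : wl x = u x by apply: uE.
  by apply: val_inj; rewrite wlE w'E wu.
(* The sum of the old graph and of the graph of [wl] over [ga]; by [Hw] the two are compatible on
   the overlap, where g is in X. *)
pose H' (p : F * cover) := exists x e g, H (x, e) /\ p = (x + ga g, e + wl g).
have sHH' p : H p -> H' p.
  case: p => x e Hx; exists x, e, 0.
  by rewrite !linear0 !addr0.
exists H'; last first.
  split=> //; exists (wl (fterm_pi (t_gen R))); exists 0, 0, (fterm_pi (t_gen R)).
  by rewrite !add0r gaE; split=> //; apply: (submod0 gH.1).
have gH' : pgraph H'.
  split; first split.
  - by apply: sHH'; apply: (submod0 gH.1).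
  - move=> a _ _ [x [e [g [Hx ->]]]] [y [e' [g' [Hy ->]]]].
    exists (a *: x + y), (a *: e + e'), (a *: g + g'); split.
      exact: (gH.1.2 a _ _ Hx Hy).
    by congr pair; rewrite /= linearP scalerDr addrACA.
  move=> _ [x [e [g [Hx [/esym/eqP xg ->]]]]]; rewrite addr_eq0 in xg.
  have Xg : X g.
    exists (- e); have : H (- x, - e) by apply: (submodN gH.1 Hx).
    by rewrite (eqP xg) opprK.
  apply: gH.2; have : H (x + ga g, e + wl g) by apply: (submodD gH.1 Hx (Hw g Xg)).
  by rewrite (eqP xg) addNr.
have sD' : submod (fun x => exists e, H' (x, e)).
  split; first by exists 0; apply: (submod0 gH'.1).
  by move=> a x y [e Hx] [e' Hy]; exists (a *: e + e'); apply: (gH'.1.2 a _ _ Hx Hy).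
split=> // [n r x _ [e [y [e' [g [Hy [xE _]]]]]]|x e [y [e' [g [Hy [-> ->]]]]]]; last first.
  by rewrite (linearD f) -(Hf _ _ Hy) -wv -w'E -wlE.
(* Flatness modulo the new domain: the right-hand side is the value of a term up to D, so [t_sol]
   provides a solution in the image of [ga]; the difference of the two solutions satisfies a
   relation modulo D. *)
have [t tE] := gaT g; rewrite tE gaE -/ev in xE.
have Dsol : D (\sum_i r i *: sol n r (ev t) i - ev t).
  apply: solP; exists x; rewrite xE addrK; by exists e'.
have [//||m [A [z [_ rA DA]]]] := flH n r (fun i => x i - sol n r (ev t) i).
  under eq_bigr do rewrite scalerBr.
  rewrite big_split /= sumrN xE -addrA -opprB; apply: (submodB sD) => //; by exists e'.
exists m, A, z; split=> // i.
have -> : x i - \sum_j A i j *: z j =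
    (x i - sol n r (ev t) i - \sum_j A i j *: z j) + sol n r (ev t) i.
  by rewrite addrAC subrK.
apply: (submodD sD').
  by have [e1 He1] := DA i; exists e1; apply: sHH'.
exists (wl (fterm_pi (t_sol r t i))), 0, 0, (fterm_pi (t_sol r t i)).
by rewrite !add0r gaE; split=> //; apply: (submod0 gH.1).
Qed.

Lemma cover_lift : exists h : {linear F -> cover}, forall x, (\val (h x)).1 = f x.
Proof.
have [||H [gH flH Hf] Hmax] := @Zorn_max _ plift (fun p => p = 0).
- split=> [|n r x _ [e [rx0 _]]|x e [-> ->]]; last by rewrite !linear0.
    split; last by move=> e [].
    by split=> // a _ _ -> ->; rewrite scaler0 addr0.
  have [m [A [y [rA xE]]]] := flF rx0.
  by exists m, A, y; split=> // i; exists 0; rewrite xE subrr.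
- move=> Fam [H0 FH0] FP totF.
  have sU : submod (fun p : F * cover => exists2 A, Fam A & A p).
    split.
      by exists H0 => //; have [gH _ _] := FP _ FH0; apply: (submod0 gH.1).
    move=> a x y [B FB Bx] [C FC Cy]; have [sBC|sCB] := totF B C FB FC.
      exists C => //; have [gC _ _] := FP _ FC.
      by apply: gC.1.2 => //; apply: sBC.
    exists B => //; have [gB _ _] := FP _ FB.
    by apply: gB.1.2 => //; apply: sCB.
  split.
  - split=> // e [B FB Be]; have [gB _ _] := FP _ FB; exact: gB.2.
  - move=> n r x _ [e [B FB Be]]; have [_ flB _] := FP _ FB.
    have [//||m [A [y [_ rA xE]]]] := flB n r x; first by exists e.
    exists m, A, y; split=> // i; have [e' Be'] := xE i.
    by exists e', B.
  - by move=> x e [B FB Be]; have [_ _] := FP _ FB; apply.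
have [|h hH] := pgraph_total gH.
  move=> x; have [|H' lH' [sHH' [e He]]] := @plift_extend H x; first by split.
  by exists e; apply: (Hmax H').
by exists h => x; apply: Hf.
Qed.

End Lift.

Lemma flat_precover_exists :
  exists (F : lmodType R) (g : {linear F -> N}), flat_precover g.
Proof.
have [g gE] := cover_map; exists cover, g; split; first exact: cover_flat.
move=> F /flat_eqflat flF f; have [h hE] := cover_lift f flF.
by exists h => x; rewrite gE hE.
Qed.

End Precovers.

(** * Coherent rings and finitely presented modules *)

Section RowVectors.

Variable S : pzRingType.

Lemma row_linear n (V : lmodType S) (e : 'I_n -> V) :
  exists g : {linear 'rV[S]_n -> V}, forall x, g x = \sum_i x 0 i *: e i.
Proof.
have [a x y|g gE] := @mk_linear S 'rV[S]_n V (fun x => \sum_i x 0 i *: e i).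
  rewrite scaler_sumr -big_split /=; apply: eq_bigr => i _.
  by rewrite !mxE scalerDl scalerA.
by exists g.
Qed.

Lemma row_linearE n (V : lmodType S) (g : {linear 'rV[S]_n -> V}) x :
  g x = \sum_i x 0 i *: g (delta_mx 0 i).
Proof.
rewrite {1}(row_sum_delta x) linear_sum.
by apply: eq_bigr => i _; rewrite linearZ.
Qed.

Lemma row_linear_delta n (V : lmodType S) (e : 'I_n -> V) i :
  \sum_j (delta_mx 0 i : 'rV[S]_n) 0 j *: e j = e i.
Proof.
rewrite (bigD1 i) //= mxE !eqxx scale1r big1 ?addr0 // => j ji.
by rewrite mxE (negPf ji) andbF scale0r.
Qed.

Lemma linear_factor (V M N : lmodType S) (g : {linear V -> M}) (l : {linear V -> N}) :
  (forall y, exists x, g x = y) -> (forall x, g x = 0 -> l x = 0) ->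
  exists h : {linear M -> N}, forall x, h (g x) = l x.
Proof.
move=> gsurj lker; have /choice[s sE] := gsurj.
have lE x x' : g x = g x' -> l x = l x'.
  move=> E; apply/eqP; rewrite -subr_eq0 -linearB; apply/eqP/lker.
  by rewrite linearB E subrr.
have [a x y|h hE] := @mk_linear S M N (fun y => l (s y)).
  by rewrite -linearP; apply: lE; rewrite linearP !sE.
by exists h => x; rewrite hE; apply: lE.
Qed.

Lemma row_lift n (V W : lmodType S) (g : {linear 'rV[S]_n -> W}) (h : {linear V -> W}) :
  (forall y, exists x, h x = y) ->
  exists p : {linear 'rV[S]_n -> V}, forall x, h (p x) = g x.
Proof.
move=> hsurj; have /choice[e eE] i := hsurj (g (delta_mx 0 i)).
have [p pE] := row_linear e; exists p => x.
rewrite pE linear_sum [RHS]row_linearE.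
by apply: eq_bigr => i _; rewrite linearZ /= eE.
Qed.

(* As in Schanuel's lemma: if p and q lift g' and g through each other, then
   ker g is generated by the image of p f' and by that of id - p q. *)
Lemma fin_presented_kernel n (M : lmodType S) (g : {linear 'rV[S]_n -> M}) :
  fin_presented M -> (forall y, exists x, g x = y) ->
  exists m (f : {linear 'rV[S]_m -> 'rV[S]_n}), forall x, g x = 0 <-> exists z, f z = x.
Proof.
move=> [m' [n' [f' [g' [g'surj kerg']]]]] gsurj.
have [p pE] := row_lift g' gsurj; have [q qE] := row_lift g g'surj.
have [f fE] := row_linear (cat_fun (fun k : 'I_m' => p (f' (delta_mx 0 k)))
  (fun i : 'I_n => delta_mx 0 i - p (q (delta_mx 0 i)))).
exists (m' + n)%N, f => x.
have fE' z : f z = p (f' (lsubmx z)) + (rsubmx z - p (q (rsubmx z))).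
  rewrite fE big_split_ord /=; congr (_ + _).
    rewrite [f' _]row_linearE linear_sum; apply: eq_bigr => k _.
    by rewrite cat_funl linearZ /= mxE.
  rewrite [in RHS](row_sum_delta (rsubmx z)) (linear_sum q) (linear_sum p) -sumrB.
  by apply: eq_bigr => k _; rewrite cat_funr (linearZZ q) (linearZZ p) -scalerBr mxE.
split=> [gx0|[z <-]].
  have /kerg'[z fz] : g' (q x) = 0 by rewrite qE.
  by exists (row_mx z x); rewrite fE' row_mxKl row_mxKr fz addrC subrK.
rewrite fE' linearD linearB !pE qE subrr addr0; apply/kerg'; by exists (lsubmx z).
Qed.

Lemma fin_presented_hom (M : lmodType S) : fin_presented M ->
  exists m n (C : 'I_m -> 'I_n -> S) (e : 'I_n -> M),
  [/\ forall k, \sum_i C k i *: e i = 0,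
      forall (N : lmodType S) (nu : 'I_n -> N), (forall k, \sum_i C k i *: nu i = 0) ->
        exists h : {linear M -> N}, forall i, h (e i) = nu i &
      forall (N : lmodType S) (h h' : {linear M -> N}),
        (forall i, h (e i) = h' (e i)) -> h =1 h'].
Proof.
move=> [m [n [f [g [gsurj kerg]]]]].
exists m, n, (fun k i => f (delta_mx 0 k) 0 i), (fun i => g (delta_mx 0 i)).
split=> [k|N nu Cnu|N h h' E y].
- by rewrite -row_linearE; apply/kerg; exists (delta_mx 0 k).
- have [l lE] := row_linear nu.
  have lker x : g x = 0 -> l x = 0.
    move=> /kerg[z <-]; rewrite [f z]row_linearE linear_sum big1 // => k _.
    by rewrite linearZ /= lE Cnu scaler0.
  have [h hE] := linear_factor gsurj lker.
  by exists h => i; rewrite hE lE row_linear_delta.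
- have [x <-] := gsurj y; rewrite row_linearE !linear_sum.
  by apply: eq_bigr => i _; rewrite !linearZ /= E.
Qed.

(** The module is S^n modulo the row r. Relations with coefficients r thus become maps from a
    finitely presented module, and flatness can be tested by factoring them. *)
Lemma cyclic_relation_presented n (r : 'I_n -> S) :
  exists (M : lmodType S) (e : 'I_n -> M), [/\ fin_presented M,
    \sum_i r i *: e i = 0 &
    forall (N : lmodType S) (nu : 'I_n -> N), \sum_i r i *: nu i = 0 ->
      exists h : {linear M -> N}, forall i, h (e i) = nu i].
Proof.
have [f fE] := row_linear (fun k : 'I_1 => \row_i r i).
have sP : submod (fun x => exists z, f z = x).
  split; first by exists 0; rewrite linear0.
  by move=> a _ _ [x <-] [y <-]; exists (a *: x + y); rewrite linearP.
have [M [g [gsurj kerg]]] := quotient_exists sP.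
exists M, (fun i => g (delta_mx 0 i)).
have fpM : fin_presented M by exists 1%N, n, f, g.
split=> //.
  have -> : \sum_i r i *: g (delta_mx 0 i) = g (\row_i r i).
    by rewrite [RHS]row_linearE; apply: eq_bigr => i _; rewrite mxE.
  apply/kerg; exists (delta_mx 0 0); by rewrite fE big_ord1 mxE !eqxx scale1r.
move=> N nu rnu; have [l lE] := row_linear nu.
have lker x : g x = 0 -> l x = 0.
  move=> /kerg[z <-]; rewrite fE big_ord1 linearZ /= lE.
  by under eq_bigr do rewrite mxE; rewrite rnu scaler0.
have [h hE] := linear_factor gsurj lker.
by exists h => i; rewrite hE lE row_linear_delta.
Qed.

End RowVectors.

Section Coherence.

Variable R : pzRingType.

(** Finite generation of the right module of syzygies of each finite row r. *)
Definition relations_fg : Prop := forall n (r : 'I_n -> R),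
  exists m (A : 'I_n -> 'I_m -> R), (forall j, \sum_i r i * A i j = 0) /\
    forall c : 'I_n -> R, \sum_i r i * c i = 0 ->
      exists d : 'I_m -> R, forall i, c i = \sum_j A i j * d j.

(** The syzygies of r are the kernel of the surjection from the free right module onto the right
    ideal generated by the r_i. *)
Lemma right_coherentP : right_coherent R <-> relations_fg.
Proof.
split=> [coh n r|rel I i inji [n [g gsurj]]].
  have sI : submod (fun s : (R^c)^o => exists c : 'I_n -> R, s = \sum_i r i * c i).
    split; first by exists (fun=> 0); rewrite big1 // => i _; rewrite mulr0.
    move=> a x y [c ->] [c' ->]; exists (fun i => c i * a + c' i).
    transitivity ((\sum_i r i * c i) * a + \sum_i r i * c' i) => //.
    rewrite mulr_suml -big_split /=.
    by apply: eq_bigr => i _; rewrite mulrDr mulrA.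
  have /choice[e eE] i : exists e : subm sI, \val e = r i.
    apply: subm_ex; exists (fun j => (j == i)%:R).
    by rewrite (bigD1 i) //= eqxx mulr1 big1 ?addr0 // => j /negPf ->; rewrite mulr0.
  have [g gE] := row_linear e.
  have vgE x : \val (g x) = \sum_i r i * x 0 i :> R.
    by rewrite gE linear_sum; apply: eq_bigr => i _; rewrite linearZ /= eE.
  have gsurj y : exists x, g x = y.
    have [c cE] := submP y; exists (\row_i c i); apply: val_inj.
    by rewrite vgE [RHS]cE; apply: eq_bigr => i _; rewrite mxE.
  have [|m [f kerg]] := @fin_presented_kernel _ n _ g _ gsurj.
    by apply: (coh _ (\val : {linear subm sI -> (R^c)^o})); [apply: val_inj | exists n, g].
  exists m, (fun i j => f (delta_mx 0 j) 0 i); split=> [j|c rc0].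
    by rewrite -vgE (kerg (f (delta_mx 0 j))).2 ?linear0 //; exists (delta_mx 0 j).
  have /kerg[z fz] : g (\row_i c i) = 0.
    apply: val_inj; rewrite vgE linear0 -[RHS]rc0.
    by apply: eq_bigr => i _; rewrite mxE.
  exists (fun j => z 0 j) => i.
  have := congr1 (fun x : 'rV[R^c]_n => x 0 i) fz; rewrite mxE => <-.
  by rewrite row_linearE summxE; apply: eq_bigr => j _; rewrite mxE.
pose r k : R := i (g (delta_mx 0 k)).
have igE x : i (g x) = \sum_k r k * x 0 k :> R.
  by rewrite row_linearE linear_sum; apply: eq_bigr => k _; rewrite linearZ.
have [m [A [rA Acomplete]]] := rel n r.
have [f fE] := row_linear (fun j => \row_k A k j : 'rV[R^c]_n).
have fE' z k : f z 0 k = \sum_j A k j * z 0 j :> R.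
  by rewrite fE summxE; apply: eq_bigr => j _; rewrite !mxE.
exists m, n, f, g; split=> // x; split=> [gx0|[z <-]].
  have [|d dE] := Acomplete (fun k => x 0 k).
    by rewrite -igE gx0 linear0.
  exists (\row_j d j); apply/rowP => k; rewrite fE' dE.
  by apply: eq_bigr => j _; rewrite mxE.
apply: inji; rewrite linear0 igE.
under eq_bigr do rewrite fE' mulr_sumr.
rewrite exchange_big big1 //= => j _.
by under eq_bigr do rewrite mulrA; rewrite -mulr_suml rA mul0r.
Qed.

Lemma charr_sum (N : lmodType R^c) (I : Type) (s : seq I) (f : I -> charr N) x :
  char_fun (\sum_(i <- s) f i) x = \sum_(i <- s) char_fun (f i) x.
Proof. by elim/big_rec2: _ => // i y e _ <-. Qed.

Lemma single_sum (I : finType) (B V : zmodType) (i : I) (b : B) (f : I -> B -> V) :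
  (forall j, f j 0 = 0) -> \sum_j f j (single i b j) = f i b.
Proof.
move=> f0; rewrite (bigD1 i) //= /single eqxx big1 ?addr0 // => j /negPf ->.
exact: f0.
Qed.

(** Let A generate the syzygies of r. To solve x = A y, extend to a character of E^m the assignment
    nu A |-> sum x_i(nu_i). It is well defined: if nu A = 0, then r_i |-> nu_i respects the
    syzygies, so nu_i = nu0 r_i by injectivity of E, and sum x_i(nu0 r_i) = (r x)(nu0) = 0. *)
Lemma coherent_charr_flat (E : lmodType R^c) :
  right_coherent R -> baer E -> eqflat (charr E).
Proof.
move=> /right_coherentP rel bE n r x rx0; have [m [A [rA Acomplete]]] := rel n r.
have [||y yE] := @char_ext_family 'I_m E (fun p => exists2 nu : 'I_n -> E,
  (forall j, p.1 j = \sum_i (A i j : R^c) *: nu i) & p.2 = \sum_i char_fun (x i) (nu i)).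
- split.
    exists 0 => [j|] /=; first by rewrite big1 // => i _; rewrite scaler0.
    by rewrite big1 // => i _; rewrite raddf0.
  move=> [mu e] [mu' e'] /= [nu muE ->] [nu' muE' ->]; exists (nu - nu') => [j|].
    transitivity (mu j - mu' j); first by [].
    by rewrite muE muE' -sumrB; apply: eq_bigr => i _; rewrite -scalerBr.
  by rewrite -sumrB; apply: eq_bigr => i _; rewrite -raddfB.
- move=> _ [nu /= mu0 ->].
  have [|nu0 nu0E] := bE (fun p => exists2 c : 'I_n -> R,
      p.1 = \sum_i r i * c i & p.2 = \sum_i (c i : R^c) *: nu i).
    split.
      split.
        exists (fun=> 0) => /=; first by rewrite big1 // => i _; rewrite mulr0.
        by rewrite big1 // => i _; rewrite scale0r.
      move=> a [? ?] [? ?] /= [c -> ->] [c' -> ->]; exists (fun i => c i * a + c' i).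
        transitivity ((\sum_i r i * c i) * a + \sum_i r i * c' i) => //.
        rewrite mulr_suml -big_split /=.
        by apply: eq_bigr => i _; rewrite mulrDr mulrA.
      rewrite scaler_sumr -big_split /=; apply: eq_bigr => i _.
      by rewrite scalerA -scalerDl.
    move=> e [c /= /esym /Acomplete[d dE] ->].
    transitivity (\sum_i \sum_j (d j : R^c) *: ((A i j : R^c) *: nu i)).
      apply: eq_bigr => i _; rewrite dE (scaler_suml (nu i) (I := 'I_m) (R := R^c)).
      by apply: eq_bigr => j _; rewrite scalerA.
    rewrite exchange_big big1 //= => j _; rewrite -scaler_sumr -mu0.
    exact: scaler0.
  have nuE i : nu i = (r i : R^c) *: nu0.
    apply: nu0E; exists (fun j => (j == i)%:R).
      by rewrite (bigD1 i) //= eqxx mulr1 big1 ?addr0 // => j /negPf ->; rewrite mulr0.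
    by rewrite (bigD1 i) //= eqxx scale1r big1 ?addr0 // => j /negPf ->; exact: scale0r.
  under eq_bigr do rewrite nuE.
  by have := congr1 (fun f => char_fun f nu0) rx0; rewrite charr_sum.
exists m, A, y; split=> // i; apply: charP => a; rewrite charr_sum.
symmetry; apply: (yE (fun j => (A i j : R^c) *: a)); exists (single i a) => [j|] /=.
  by rewrite (single_sum i a (f := fun i a => (A i j : R^c) *: a)) // => k; rewrite scaler0.
by rewrite (single_sum i a (f := fun i a => char_fun (x i) a)) // => k; rewrite raddf0.
Qed.
End Coherence.

(** * Chase's theorem: flat duals of injectives force coherence *)

Section OrthogonalFlat.

Variables (R : pzRingType) (N : lmodType R^c) (Z : N -> Prop).
Variables (n : nat) (r : 'I_n -> R).

Hypothesis flN : eqflat (charr N).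
Hypothesis sZ : submod Z.
Hypothesis pureZ : forall m (A : 'I_n -> 'I_m -> R^c) (nu : 'I_n -> N),
  (forall j, Z (\sum_i A i j *: nu i)) ->
  exists nu' : 'I_n -> N, (forall i, Z (nu i - nu' i)) /\
    forall j, \sum_i A i j *: nu' i = 0.

(* If eps were not in N r modulo Z, some characters x of N / Z would satisfy
   r x = 0 and x(eps) <> 0; but x = A y with r A = 0, while eps A is 0 modulo Z. *)
Lemma orthogonal_flat (eps : 'I_n -> N) :
  (forall m (A : 'I_n -> 'I_m -> R), (forall j, \sum_i r i * A i j = 0) ->
    forall j, Z (\sum_i (A i j : R^c) *: eps i)) ->
  exists nu0 : N, forall i, Z (eps i - (r i : R^c) *: nu0).
Proof.
move=> Zeps; apply: contrapT => nY.
have [||x x0 []] := @char_sep_family 'I_n N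
  (fun nu => exists nu0 : N, forall i, Z (nu i - (r i : R^c) *: nu0)) eps.
- split.
    by exists 0 => i; rewrite scaler0 subr0; apply: (submod0 sZ).
  move=> x y [x0 xE] [y0 yE]; exists (x0 - y0) => i.
  have -> : (x - y) i - (r i : R^c) *: (x0 - y0) =
      (x i - (r i : R^c) *: x0) - (y i - (r i : R^c) *: y0).
    by rewrite scalerBr [(x - y) i]/GRing.add /= !opprD addrACA.
  exact: (submodB sZ).
- exact: nY.
have xZ i z : Z z -> char_fun (x i) z = 0.
  move=> Zz; rewrite -[RHS](x0 (single i z)).
    by rewrite (single_sum i z (f := fun i z => char_fun (x i) z)) // => k; rewrite raddf0.
  exists 0 => k; rewrite scaler0 subr0 /single; case: ifP => // _.
  exact: (submod0 sZ).
have [|m [A [y [rA xE]]]] := flN (r := r) (x := x).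
  apply: charP => a; rewrite charr_sum -[RHS](x0 (fun i => (r i : R^c) *: a)) //.
  by exists a => i; rewrite subrr; apply: (submod0 sZ).
have [eps' [Zeps' Aeps']] := pureZ (Zeps m A rA).
transitivity (\sum_i char_fun (x i) (eps' i)).
  by apply: eq_bigr => i _; apply/eqP; rewrite -subr_eq0 -raddfB; apply/eqP/xZ.
transitivity (\sum_i \sum_j char_fun (y j) ((A i j : R^c) *: eps' i)).
  by apply: eq_bigr => i _; rewrite xE charr_sum.
by rewrite exchange_big big1 //= => j _; rewrite -raddf_sum Aeps' raddf0.
Qed.

End OrthogonalFlat.

Section Chase.

Variables (R : pzRingType) (n : nat) (r : 'I_n -> R).

Local Notation W := ('I_n -> (R^c)^o).

Definition fg_by m (A : 'I_n -> 'I_m -> R) (c : W) : Prop :=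
  exists d : 'I_m -> R, forall i, c i = \sum_j A i j * d j.

Definition fg_rel (P : W -> Prop) : Prop :=
  exists m (A : 'I_n -> 'I_m -> R),
    (forall j, \sum_i r i * A i j = 0) /\ P = fg_by A.

Lemma fg_rel_submod P : fg_rel P -> submod P.
Proof.
move=> [m [A [_ ->]]]; split.
  by exists (fun=> 0) => i; rewrite big1 // => j _; rewrite mulr0.
move=> a x y [d xE] [d' yE]; exists (fun j => d j * a + d' j) => i.
transitivity ((\sum_j A i j * d j) * a + \sum_j A i j * d' j).
  by rewrite -xE -yE.
by rewrite mulr_suml -big_split /=; apply: eq_bigr => j _; rewrite mulrDr mulrA.
Qed.

Lemma fg_rel_join P Q : fg_rel P -> fg_rel Q ->
  exists T, [/\ fg_rel T, forall c, P c -> T c & forall c, Q c -> T c].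
Proof.
move=> [m [A [rA ->]]] [m' [A' [rA' ->]]].
exists (fg_by (fun i => cat_fun (A i) (A' i))); split.
- exists (m + m')%N, (fun i => cat_fun (A i) (A' i)); split=> // j.
  by rewrite /cat_fun; case: (fintype.split j) => k; [apply: rA | apply: rA'].
- move=> c [d cE]; exists (cat_fun d (fun=> 0)) => i; rewrite big_split_ord /= cE.
  rewrite [X in _ + X]big1 => [|k _]; last by rewrite !cat_funr mulr0.
  by rewrite addr0; apply: eq_bigr => k _; rewrite !cat_funl.
- move=> c [d cE]; exists (cat_fun (fun=> 0) d) => i; rewrite big_split_ord /= cE.
  rewrite [X in X + _]big1 => [|k _]; last by rewrite !cat_funl mulr0.
  by rewrite add0r; apply: eq_bigr => k _; rewrite !cat_funr.
Qed.

Lemma fg_rel0 : exists P, fg_rel P.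
Proof.
exists (fg_by (fun _ => fun k : 'I_0 => 0)), 0%N, (fun _ => fun=> 0).
by split=> // [[]].
Qed.

Local Notation N := ((W -> Prop) -> (char W -> coind R^c)).

(** The kernel of the map from the product to the reduced product along the finitely generated
    modules of relations, directed by inclusion. *)
Definition eventually0 (psi : N) : Prop := exists2 P0, fg_rel P0 &
  forall P, fg_rel P -> (forall c, P0 c -> P c) -> psi P = 0.

Lemma eventually0_submod : submod eventually0.
Proof.
split; first by have [P fP] := fg_rel0; exists P.
move=> a x y [P fP xP] [Q fQ yQ]; have [T [fT PT QT]] := fg_rel_join fP fQ.
exists T => // U fU TU.
transitivity (a *: x U + y U); first by [].
rewrite xP ?yQ // ?scaler0 ?addr0 // => c; [move=> /QT|move=> /PT]; exact: TU.
Qed.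

Lemma eventually0_family m (psi : 'I_m -> N) : (forall j, eventually0 (psi j)) ->
  exists2 P0, fg_rel P0 &
    forall j P, fg_rel P -> (forall c, P0 c -> P c) -> psi j P = 0.
Proof.
elim: m psi => [|m IHm] psi H.
  by have [P fP] := fg_rel0; exists P => // [[]].
have [P fP HP] := IHm _ (fun j => H (fintype.lift ord0 j)).
have [Q fQ HQ] := H ord0; have [T [fT PT QT]] := fg_rel_join fP fQ.
exists T => // j U fU TU; case: (unliftP ord0 j) => [k|] ->.
  by apply: HP => // c /PT; apply: TU.
by apply: HQ => // c /QT; apply: TU.
Qed.

(** Replacing nu by 0 at all P except the finitely generated ones above P0 changes it only by
    eventually zero functions, and then the system holds at every P. *)
Lemma eventually0_pure m (A : 'I_n -> 'I_m -> R^c) (nu : 'I_n -> N) :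
  (forall j, eventually0 (\sum_i A i j *: nu i)) ->
  exists nu' : 'I_n -> N, (forall i, eventually0 (nu i - nu' i)) /\
    forall j, \sum_i A i j *: nu' i = 0.
Proof.
move=> /eventually0_family[P0 fP0 HP0].
pose big P := fg_rel P /\ (forall c, P0 c -> P c).
pose cut (psi : N) : N := fun P => if pselect (big P) then psi P else 0.
exists (fun i => cut (nu i)); split=> [i|j].
  exists P0 => // P fP P0P.
  transitivity (nu i P - cut (nu i) P); first by [].
  by rewrite /cut; case: pselect => [?|[]//]; rewrite subrr.
apply/funext => P; rewrite fct_sumE.
have [bP|nbP] := pselect (big P); last first.
  rewrite big1 // => i _; transitivity (A i j *: cut (nu i) P) => //.
  by rewrite /cut; case: pselect => // ?; rewrite scaler0.
transitivity ((\sum_i A i j *: nu i) P); last exact: (HP0 j P bP.1 bP.2).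
rewrite [in RHS]fct_sumE; apply: eq_bigr => i _.
transitivity (A i j *: cut (nu i) P) => //.
by rewrite /cut; case: pselect.
Qed.

(* N is a product of injective modules indexed by the modules P of relations of r,
   and e maps R^n to the component P with kernel P. If e is a multiple of r from
   some P0 on, then every relation of r is in P0. *)
Lemma charr_flat_relations : eqflat (charr N) ->
  exists m (A : 'I_n -> 'I_m -> R), (forall j, \sum_i r i * A i j = 0) /\
    forall c : 'I_n -> R, \sum_i r i * c i = 0 ->
      exists d : 'I_m -> R, forall i, c i = \sum_j A i j * d j.
Proof.
move=> flN.
have /choice[q qE] (P : W -> Prop) : exists q : {linear W -> (char W -> coind R^c)},
    fg_rel P -> forall c, q c = 0 <-> P c.
  have [fP|nfP] := pselect (fg_rel P); last by exists \0.
  by have [q qE] := quotient_embedding (fg_rel_submod fP); exists q.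
have [a x y|e eE] := @mk_linear _ W N (fun c P => q P c).
  by apply/funext => P; rewrite linearP.
pose de i : W := fun j => (j == i)%:R.
have edeE (c : W) : e c = \sum_i (c i : R^c) *: e (de i).
  have {1}-> : c = \sum_i (c i : R^c) *: de i.
    apply/funext => j; rewrite fct_sumE (bigD1 j) //= big1 => [|i ij].
      rewrite addr0 /GRing.scale /= /GRing.scale /= /de eqxx.
      exact: (esym (mul1r (c j : R))).
    rewrite /GRing.scale /= /GRing.scale /= /de eq_sym (negPf ij).
    exact: (mul0r (c i : R)).
  by rewrite linear_sum; apply: eq_bigr => i _; rewrite linearZ.
(* If r A = 0, each column of A lies in every P containing [fg_by A], so [e] maps it to an
   eventually zero function. *)
have [m A rA j|nu0 nu0E] := @orthogonal_flat R N eventually0 n r flN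
    eventually0_submod eventually0_pure (fun i => e (de i)).
  exists (fg_by A); first by exists m, A.
  move=> P fP AP; rewrite -(edeE (fun i => A i j)) eE; apply/qE => //; apply: AP.
  exists (fun k => (k == j)%:R) => i.
  by rewrite (bigD1 j) //= eqxx mulr1 big1 ?addr0 // => k /negPf ->; rewrite mulr0.
have [P0 fP0 HP0] := eventually0_family nu0E.
have eqP0 i : e (de i) P0 = (r i : R^c) *: nu0 P0.
  apply/eqP; rewrite -subr_eq0; apply/eqP; exact: HP0.
case: (fP0) => m [A [rA P0E]]; exists m, A; split=> // c rc0.
suff: P0 c by rewrite P0E.
apply/(qE P0 fP0); transitivity (e c P0); first by rewrite eE.
rewrite edeE fct_sumE.
transitivity (\sum_i (c i : R^c) *: ((r i : R^c) *: nu0 P0)).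
  by apply: eq_bigr => i _; rewrite -eqP0.
transitivity ((\sum_i r i * c i : R^c) *: nu0 P0); last by rewrite rc0 scale0r.
rewrite (scaler_suml (nu0 P0)); apply: eq_bigr => i _; exact: scalerA.
Qed.

End Chase.

Lemma charr_flat_coherent (R : pzRingType) :
  (forall E : lmodType R^c, baer E -> eqflat (charr E)) -> right_coherent R.
Proof.
move=> fl; apply/right_coherentP => n r; apply: charr_flat_relations.
by apply: fl; do 2!apply: baer_fun; apply: coind_baer.
Qed.

(** * Completing domains and biduals *)

Section BidualSystems.

Variables (R : pzRingType) (m n : nat) (C : 'I_m -> 'I_n -> R).

(** For M presented by the matrix [C], this is surjectivity of Hom(M, G) -> Hom(M, N). *)
Definition solutions_lift (G N : lmodType R) (p : {linear G -> N}) : Prop :=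
  forall nu : 'I_n -> N, (forall k, \sum_i C k i *: nu i = 0) ->
  exists2 ga : 'I_n -> G, (forall k, \sum_i C k i *: ga i = 0) &
    forall i, p (ga i) = nu i.

Variables (G N : lmodType R) (p : {linear G -> N}).
Variables (pl : {linear charl N -> charl G}).
Variables (pp : {linear charr (charl G) -> charr (charl N)}).
Hypothesis plE : forall chi x, char_fun (pl chi) x = char_fun chi (p x).
Hypothesis ppE : forall Phi chi, char_fun (pp Phi) chi = char_fun Phi (pl chi).

(** The solution in G^++ is a character of (G^+)^n that sends pl(chi) + xi C to sum Phi_i(chi_i). It
    is well defined: if pl(chi) = - xi C, then chi kills the images of solutions in G, hence all
    solutions in N, so chi = xi' C for some xi', and Phi kills it because C Phi = 0. *)
Lemma solutions_lift_bidual : solutions_lift p -> solutions_lift pp.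
Proof.
move=> lift_p Phi CPhi.
have PhiC (xi : 'I_m -> charl N) :
    \sum_i char_fun (Phi i) (\sum_k (C k i : R^c) *: xi k) = 0.
  transitivity (\sum_i \sum_k char_fun (C k i *: Phi i) (xi k)).
    by apply: eq_bigr => i _; rewrite raddf_sum.
  by rewrite exchange_big big1 //= => k _; rewrite -charr_sum CPhi.
have [||Ga GaE] := @char_ext_family 'I_n (charl G) (fun q =>
  exists (chi : 'I_n -> charl N) (xi : 'I_m -> charl G),
    (forall i, q.1 i = pl (chi i) + \sum_k (C k i : R^c) *: xi k) /\
    q.2 = \sum_i char_fun (Phi i) (chi i)).
- split.
    exists 0, 0; split=> [i|] /=.
      rewrite linear0 add0r big1 // => k _; exact: scaler0.
    by rewrite big1 // => i _; rewrite raddf0.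
  move=> [mu e] [mu' e'] /= [chi [xi [muE ->]]] [chi' [xi' [muE' ->]]].
  exists (chi - chi'), (xi - xi'); split=> [i|].
    transitivity (mu i - mu' i); first by [].
    rewrite muE muE' opprD addrACA -linearB -sumrB; congr (_ + _).
    by apply: eq_bigr => k _; rewrite -scalerBr.
  by rewrite -sumrB; apply: eq_bigr => i _; rewrite -raddfB.
- move=> _ [chi [xi [/= mu0 ->]]].
  have [||xi' xi'E] := @char_ext_family 'I_m N (fun q => exists2 nu : 'I_n -> N,
    (forall k, q.1 k = \sum_i C k i *: nu i) & q.2 = \sum_i char_fun (chi i) (nu i)).
  + split.
      exists 0 => [k|] /=; first by rewrite big1 // => i _; rewrite scaler0.
      by rewrite big1 // => i _; rewrite raddf0.
    move=> [rho e] [rho' e'] /= [nu rhoE ->] [nu' rhoE' ->]; exists (nu - nu') => [k|].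
      transitivity (rho k - rho' k); first by [].
      by rewrite rhoE rhoE' -sumrB; apply: eq_bigr => i _; rewrite -scalerBr.
    by rewrite -sumrB; apply: eq_bigr => i _; rewrite -raddfB.
  + move=> _ [nu /= Cnu ->]; have [|ga Cga gaE] := lift_p nu.
      by move=> k; rewrite -Cnu.
    transitivity (- \sum_i \sum_k char_fun (xi k) (C k i *: ga i)).
      rewrite -sumrN; apply: eq_bigr => i _; rewrite -gaE -plE.
      have /(congr1 (fun f => char_fun f (ga i))) := mu0 i.
      move=> /esym/eqP; rewrite -[X in X == _]/(_ + char_fun (\sum_k _) (ga i)).
      by rewrite charl_sum addr_eq0 => /eqP.
    rewrite exchange_big big1 ?oppr0 //= => k _.
    by rewrite -raddf_sum Cga raddf0.
  have chiE i : chi i = \sum_k (C k i : R^c) *: (xi' k : charl N).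
    apply: charP => a; rewrite charl_sum.
    symmetry; apply: (xi'E (fun k => C k i *: a)); exists (single i a) => [k|] /=.
      by rewrite (single_sum i a (f := fun i a => C k i *: a)) // => j; rewrite scaler0.
    by rewrite (single_sum i a (f := fun i a => char_fun (chi i) a)) // => j; rewrite raddf0.
  by under eq_bigr do rewrite chiE; rewrite PhiC.
exists (Ga : 'I_n -> charr (charl G)) => [k|i].
  apply: charP => xi; rewrite charr_sum.
  apply: (GaE (fun i => (C k i : R^c) *: (xi : charl G))).
  exists 0, (single k xi); split=> [i|] /=.
    rewrite linear0 add0r.
    by rewrite (single_sum k xi (f := fun k xi => (C k i : R^c) *: (xi : charl G))) //
       => j; rewrite scaler0.
  by rewrite big1 // => i _; rewrite raddf0.
apply: charP => chi; rewrite ppE.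
have := GaE (single i (pl chi)) (char_fun (Phi i) chi).
rewrite (single_sum i (pl chi) (f := fun i x => char_fun (Ga i) x)) => [|j]; last first.
  by rewrite raddf0.
apply; exists (single i chi), 0; split=> [j|] /=.
  rewrite [X in _ + X]big1 ?addr0 => [|k _]; last exact: scaler0.
  by rewrite /single; case: ifP => // _; rewrite linear0.
by rewrite (single_sum i chi (f := fun i x => char_fun (Phi i) x)) // => j; rewrite raddf0.
Qed.

(** If nu does not lift, a character (chi, xi) separates (nu, 0) from all (p ga, C ga), so pl(chi) =
    - xi C. A lift Ga of the image of nu in N^++ then gives sum chi_i(nu_i) = sum Ga_i(pl(chi_i)) =
    0, as C Ga = 0. *)
Lemma solutions_lift_of_bidual : solutions_lift pp -> solutions_lift p.
Proof.
move=> lift_pp nu Cnu; apply: contrapT => nlift.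
have [||ze ze0 zenu] := @char_sep (('I_n -> N) * ('I_m -> G))%type
  (fun q => exists ga : 'I_n -> G, (forall i, q.1 i = p (ga i)) /\
    forall k, q.2 k = \sum_i C k i *: ga i) (nu, 0).
- split.
    exists 0; split=> [i|k] /=; first by rewrite linear0.
    by rewrite big1 // => i _; rewrite scaler0.
  move=> [q1 q2] [q1' q2'] /= [ga [E1 E2]] [ga' [E1' E2']]; exists (ga - ga').
  split=> [i|k]; first by rewrite linearB -E1 -E1'.
  transitivity (q2 k - q2' k); first by [].
  by rewrite E2 E2' -sumrB; apply: eq_bigr => i _; rewrite -scalerBr.
- move=> [ga [/= gaE Cga]]; apply: nlift; exists ga => [k|i]; first by rewrite -Cga.
  by rewrite -gaE.
have [chi chiE] : exists chi : 'I_n -> charl N,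
    forall mu, ze (mu, 0) = \sum_i char_fun (chi i) (mu i).
  have [x y|z zE] := @mk_additive ('I_n -> N) QZ (fun mu => ze (mu, 0)).
    by rewrite -raddfD; congr (ze (_, _)); rewrite addr0.
  have [chi chiE] := char_family (z : char ('I_n -> N)).
  by exists chi => mu; rewrite -zE -chiE.
have [xi xiE] : exists xi : 'I_m -> charl G,
    forall rho, ze (0, rho) = \sum_k char_fun (xi k) (rho k).
  have [x y|z zE] := @mk_additive ('I_m -> G) QZ (fun rho => ze (0, rho)).
    by rewrite -raddfD; congr (ze (_, _)); rewrite addr0.
  have [xi xiE] := char_family (z : char ('I_m -> G)).
  by exists xi => mu; rewrite -zE -xiE.
have zeE mu rho : ze (mu, rho) =
    \sum_i char_fun (chi i) (mu i) + \sum_k char_fun (xi k) (rho k).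
  by rewrite -chiE -xiE -raddfD; congr (ze (_, _)); rewrite ?addr0 ?add0r.
have plchi i : pl (chi i) = - \sum_k (C k i : R^c) *: xi k.
  apply/eqP; rewrite -addr_eq0; apply/eqP/charP => a.
  transitivity (char_fun (pl (chi i)) a + char_fun (\sum_k (C k i : R^c) *: xi k) a) => //.
  rewrite charl_sum plE.
  have := ze0 (fun j => p (single i a j), fun k => \sum_j C k j *: single i a j).
  rewrite zeE.
  rewrite (single_sum i a (f := fun i x => char_fun (chi i) (p x))) => [|j]; last first.
    by rewrite linear0 raddf0.
  move=> E; rewrite -[RHS]E; last by exists (single i a).
  congr (_ + _); apply: eq_bigr => k _.
  by rewrite (single_sum i a (f := fun i x => C k i *: x)) // => j; rewrite scaler0.
have [ev evE] := charr_eval N.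
have [|Ga CGa GaE] := lift_pp (fun i => ev (nu i)).
  move=> k; rewrite -[RHS](linear0 ev) -(Cnu k) linear_sum.
  by apply: eq_bigr => i _; rewrite linearZ.
apply: zenu; rewrite chiE.
transitivity (\sum_i char_fun (Ga i) (pl (chi i))).
  by apply: eq_bigr => i _; rewrite -ppE GaE evE.
under eq_bigr do rewrite plchi raddfN raddf_sum.
rewrite sumrN exchange_big big1 ?oppr0 //= => k _.
by have := congr1 (fun f => char_fun f (xi k)) (CGa k); rewrite charr_sum.
Qed.

End BidualSystems.

(** * The implications between the three assertions *)

Section Completion.

Variable R : pzRingType.

Lemma completing_domainP (M N : lmodType R) :
  flat_completing_domain M N <->
  forall f : {linear M -> N}, exists (F : lmodType R) (h : {linear M -> F})
    (u : {linear F -> N}), flat F /\ forall x, u (h x) = f x.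
Proof.
split=> [MN f|MN f F g [flF gP]].
  have [F [g pg]] := flat_precover_exists N; have [h hE] := MN f F g pg.
  by exists F, h, g; split=> //; case: pg.
have [F' [h [u [flF' uE]]]] := MN f; have [v vE] := gP F' flF' u.
by have [w wE] := comp_linear v h; exists w => x; rewrite wE vE uE.
Qed.

Lemma flat_completing_domain_flat (M N : lmodType R) :
  flat N -> flat_completing_domain M N.
Proof. by move=> flN; apply/completing_domainP => f; exists N, f, idfun. Qed.

Lemma flat_retract (F N : lmodType R) (i : {linear N -> F}) (q : {linear F -> N}) :
  (forall x, q (i x) = x) -> flat F -> flat N.
Proof.
move=> qi /flat_eqflat flF; apply/flat_eqflat => n r x rx0.
have [|m [A [y [rA xE]]]] := flF n r (fun i0 => i (x i0)).
  rewrite -[RHS](linear0 i) -rx0 linear_sum.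
  by apply: eq_bigr => k _; rewrite linearZ.
exists m, A, (fun j => q (y j)); split=> // k; rewrite -{1}(qi (x k)) xE linear_sum.
by apply: eq_bigr => j _; rewrite linearZ.
Qed.

Lemma regular_flat : flat (R^o : lmodType R).
Proof.
apply/flat_eqflat => n r x rx0; exists 1%N, (fun i _ => x i), (fun=> 1).
by split=> // i; rewrite big_ord1 /GRing.scale /= mulr1.
Qed.

Lemma precover_surj (F N : lmodType R) (g : {linear F -> N}) :
  flat_precover g -> forall y, exists x, g x = y.
Proof.
move=> [_ gP] y; have [a s t|u uE] := @mk_linear R R^o N (fun s => (s : R) *: y).
  by rewrite scalerDl scalerA.
have [v vE] := gP _ regular_flat u; exists (v 1).
by rewrite vE uE scale1r.
Qed.

Lemma abs_pureP (M : lmodType R) (N : lmodType R^c) : abs_pure_domain M N <->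
  forall (K : lmodType R^c) (i : {linear N -> K}), injective i ->
  forall f : {linear M -> charr N}, exists h : {linear M -> charr K},
    forall m a, char_fun (h m) (i a) = char_fun (f m) a.
Proof. by split=> H K i /(H K i)/tensor_map_injP. Qed.

Lemma baer_abs_pure (M : lmodType R) (N : lmodType R^c) :
  baer N -> abs_pure_domain M N.
Proof.
move=> bN; apply/abs_pureP => K i inji f.
have [q qE] := baer_lift idfun bN inji; have [d dE] := charr_dual q.
have [h hE] := comp_linear d f.
by exists h => m a; rewrite hE dE qE.
Qed.

(** If f factors through a flat F, flatness lifts the factor u : F -> N^+ along K^+ -> N^+. *)
Lemma completing_abs_pure (M : lmodType R) (N : lmodType R^c) :
  flat_completing_domain M (charr N) -> abs_pure_domain M N.
Proof.
move=> /completing_domainP MN; apply/abs_pureP => K i inji f.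
have [F [h [u [flF uE]]]] := MN f.
have /tensor_map_injP/(_ u)[k kE] := flF _ _ i inji.
have [w wE] := comp_linear k h.
by exists w => m a; rewrite wE kE uE.
Qed.

Lemma coherent_abs_pure_completing (M : lmodType R) (N : lmodType R^c) :
  right_coherent R -> abs_pure_domain M N -> flat_completing_domain M (charr N).
Proof.
move=> coh /abs_pureP MN; apply/completing_domainP => f.
have [E [i [bE inji]]] := injective_embedding N.
have [h hE] := MN E i inji f; have [d dE] := charr_dual i.
exists (charr E), h, d; split; first exact/flat_eqflat/coherent_charr_flat.
by move=> x; apply: charP => a; rewrite dE hE.
Qed.

Lemma bidual_map (G N : lmodType R) (p : {linear G -> N}) :
  exists (pl : {linear charl N -> charl G})
         (pp : {linear charr (charl G) -> charr (charl N)}),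
  (forall chi x, char_fun (pl chi) x = char_fun chi (p x)) /\
  (forall Phi chi, char_fun (pp Phi) chi = char_fun Phi (pl chi)).
Proof.
have [pl plE] := charl_dual p; have [pp ppE] := charr_dual pl.
by exists pl, pp.
Qed.

Lemma fin_presented_lift (M : lmodType R) : fin_presented M ->
  exists m n (C : 'I_m -> 'I_n -> R), forall (G N : lmodType R) (p : {linear G -> N}),
    solutions_lift C p <->
    forall f : {linear M -> N}, exists h : {linear M -> G}, forall x, p (h x) = f x.
Proof.
move=> /fin_presented_hom[m [n [C [e [Ce homM eqM]]]]].
exists m, n, C => G N p; split=> [lift_p f|lift_f nu Cnu].
  have [k|ga Cga gaE] := lift_p (fun i => f (e i)).
    rewrite -[RHS](linear0 f) -(Ce k) linear_sum.
    by apply: eq_bigr => i _; rewrite linearZ.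
  have [h hE] := homM G ga Cga; exists h.
  by have [w wE] := comp_linear p h => x; rewrite -wE; apply: eqM => i; rewrite wE hE gaE.
have [f fE] := homM N nu Cnu; have [h hE] := lift_f f.
exists (fun i => h (e i)) => [k|i]; last by rewrite hE fE.
rewrite -[RHS](linear0 h) -(Ce k) linear_sum.
by apply: eq_bigr => i _; rewrite linearZ.
Qed.

Lemma coherent_completing_bidual (M N : lmodType R) :
  right_coherent R -> fin_presented M ->
  flat_completing_domain M N -> flat_completing_domain M (charr (charl N)).
Proof.
move=> coh /fin_presented_lift[m [n [C liftC]]] MN.
have [G [p pcov]] := flat_precover_exists N.
have [pl [pp [plE ppE]]] := bidual_map p.
apply/completing_domainP => f.
have [h hE] : exists h : {linear M -> charr (charl G)}, forall x, pp (h x) = f x.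
  move: f; apply/liftC/(solutions_lift_bidual plE ppE)/liftC => f.
  by have [h hE] := MN f G p pcov; exists h.
exists (charr (charl G)), h, pp; split=> //.
apply/flat_eqflat/coherent_charr_flat => //; apply/flat_baer; exact: pcov.1.
Qed.

Lemma bidual_completing (M N : lmodType R) : fin_presented M ->
  flat_completing_domain M (charr (charl N)) -> flat_completing_domain M N.
Proof.
move=> /fin_presented_lift[m [n [C liftC]]] /completing_domainP MN f F g pcov.
have [pl [pp [plE ppE]]] := bidual_map g.
move: f; apply/liftC/(solutions_lift_of_bidual plE ppE)/liftC => f.
have [G [h [u [flG uE]]]] := MN f.
(* A precover is onto, so its dual is injective, and the flat module through which f factors lifts
   [u] along [pp]. *)
have injpl : injective pl.
  move=> chi chi' E; apply: charP => y; have [x <-] := precover_surj pcov y.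
  by rewrite -!plE E.
have /tensor_map_injP/(_ u)[k kE] := flG _ _ pl injpl.
have [w wE] := comp_linear k h.
by exists w => x; apply: charP => chi; rewrite ppE wE kE uE.
Qed.

(** Let G be a flat precover of N^+ with N injective. A relation in G^++ is a map from a finitely
    presented M, which factors through a flat module since G, being flat, is in the completing
    domain of M; so G^++ is flat. The adjoint N -> G^+ of the precover is injective, hence split,
    and N^+ is a retract of G^++. *)
Lemma completing_bidual_coherent :
  (forall M : lmodType R, fin_presented M -> forall N : lmodType R,
    flat_completing_domain M N -> flat_completing_domain M (charr (charl N))) ->
  right_coherent R.
Proof.
move=> H; apply: charr_flat_coherent => N bN.
have [G [p pcov]] := flat_precover_exists (charr N).
have flGpp : flat (charr (charl G)).
  apply/flat_eqflat => n r x rx0.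
  have [M [e [fpM re0 homM]]] := cyclic_relation_presented r.
  have [f fE] := homM _ x rx0.
  have /completing_domainP/(_ f)[F [h [u [flF uE]]]] :=
    H M fpM G (@flat_completing_domain_flat M G pcov.1).
  have [|m [A [y [rA hE]]]] := (flat_eqflat F).1 flF n r (fun i => h (e i)).
    rewrite -[RHS](linear0 h) -re0 linear_sum.
    by apply: eq_bigr => i _; rewrite linearZ.
  exists m, A, (fun j => u (y j)); split=> // i.
  rewrite -fE -uE hE linear_sum.
  by apply: eq_bigr => j _; rewrite linearZ.
have [j jE] := charl_of_charr p.
have injj : injective j.
  move=> a b E; apply/eqP; rewrite -subr_eq0; apply/eqP; apply: contrapT.
  move=> /char_sep0[chi]; apply; have [x xE] := precover_surj pcov chi.
  by rewrite -xE -jE linearB E subrr.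
have [q qE] := baer_lift idfun bN injj.
have [jd jdE] := charr_dual j; have [qd qdE] := charr_dual q.
apply/flat_eqflat/(@flat_retract (charr (charl G)) _ qd jd) => // f.
by apply: charP => a; rewrite jdE qdE qE.
Qed.

(** An injective N is in the absolutely pure domain of N^+, so the identity of N^+ factors through a
    flat module. *)
Lemma completing_dual_coherent :
  (forall (M : lmodType R) (N : lmodType R^c),
    abs_pure_domain M N -> flat_completing_domain M (charr N)) ->
  right_coherent R.
Proof.
move=> H; apply: charr_flat_coherent => N bN; apply/flat_eqflat.
have /completing_domainP/(_ idfun)[F [h [u [flF uE]]]] :=
  H (charr N) N (baer_abs_pure bN).
exact: flat_retract uE flF.
Qed.

End Completion.

Theorem proposition3p10 (R : pzRingType) :
  (right_coherent R <->
    (forall (M : lmodType R) (N : lmodType R^c),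
      abs_pure_domain M N <-> flat_completing_domain M (charr N)))
  /\
  (right_coherent R <->
    (forall (M : lmodType R), fin_presented M ->
      forall (N : lmodType R),
        flat_completing_domain M N <->
        flat_completing_domain M (charr (charl N)))).
Proof.
split.
  split=> [coh M N|H]; last by apply: completing_dual_coherent => M N /H.
  split; first exact: coherent_abs_pure_completing.
  exact: completing_abs_pure.
split=> [coh M fpM N|H].
  split; first exact: coherent_completing_bidual.
  exact: bidual_completing.
by apply: completing_bidual_coherent => M fpM N /(H M fpM N).
Qed.
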